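(* Let $n$ and $d$ be positive integers with $d\geq 3$ and $\gcd(n,d)=1$, and let $a,b$ be indeterminates. Then \[ \sum_{k=0}^{n-1}[2dk+1]\frac{(aq,q/a,bq,q/b;q^d)_k(q;q^d)_k^2}{(aq^d,q^d/a,bq^d,q^d/b;q^d)_k(q^d;q^d)_k^2}q^{(2d-3)k} \equiv\begin{cases}0 \pmod{[n]\Phi_n(q)}, &\text{if }n\equiv -1\pmod{d},\\[5pt] 0 \pmod{[n]},&\text{otherwise}. \end{cases} \]
   Context: For an integer $m$, $[m]=[m]_q=(1-q^m)/(1-q)$ denotes the $q$-integer. The $q$-shifted factorial is $(x;q)_0=1$ and $(x;q)_k=(1-x)(1-xq)\cdots(1-xq^{k-1})$ for $k\geq1$, with $(x_1,\dots,x_m;q)_k=(x_1;q)_k\cdots(x_m;q)_k$. $\Phi_n(q)$ is the $n$-th cyclotomic polynomial in $q$. For rational functions $A,B$ in $q$ (with coefficients involving the indeterminates $a,b$) and a polynomial $P(q)$, $A\equiv B\pmod{P(q)}$ means that the numerator of $A-B$ (in reduced form) is divisible by $P(q)$ and its denominator is coprime to $P(q)$. *)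

(* Defs.v *)
From HB Require Import structures.
From mathcomp Require Import all_boot all_order all_algebra all_field.

Set Implicit Arguments.
Unset Strict Implicit.
Unset Printing Implicit Defensive.

Import GRing.Theory.
Local Open Scope ring_scope.

Section QNotation.

Variable F : fieldType.
Implicit Types (q x : F) (xs : seq F).

Definition qint q (m : int) : F := (1 - q ^ m) / (1 - q).

Definition qpoch x q (k : nat) : F := \prod_(i < k) (1 - x * q ^+ i).

Definition qpochs xs q (k : nat) : F := \prod_(x <- xs) qpoch x q k.

End QNotation.

Section Congruence.

Variable K : fieldType.

(* A reduced form u / v is unique up to a nonzero factor in K, so it does not
   matter which one is taken. *)
Definition rat_congr (A B : {fraction {poly K}}) (P : {poly K}) : Prop :=
  exists u v : {poly K},
    [/\ v != 0, coprimep u v, A - B = tofrac u / tofrac v,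
        P %| u & coprimep v P].

(* [n]_q and Phi_n(q) as elements of K[q]; the division below is exact, see
   tofrac_qint_poly. *)
Definition qint_poly (n : nat) : {poly K} := (1 - 'X^n) %/ (1 - 'X).

Definition cyclotomic_poly (n : nat) : {poly K} := map_poly intr 'Phi_n.

Lemma tofrac_qint_poly (n : nat) :
  tofrac (qint_poly n) = qint (tofrac 'X) n :> {fraction {poly K}}.
Proof.
have nz : 1 - 'X != 0 :> {poly K}.
  by rewrite -opprB oppr_eq0 polyXsubC_eq0.
have nzF : 1 - tofrac 'X != 0 :> {fraction {poly K}}.
  by rewrite -tofrac1 -tofracB tofrac_eq0.
apply: (mulIf nzF); rewrite /qint mulfVK // -exprnP.
rewrite -tofrac1 -tofracXn -!tofracB -tofracM divpK //.
by rewrite -(opprB 'X) dvdpNl -(opprB 'X^n) dvdpNr subrX1 dvdp_mulIl.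
Qed.

End Congruence.

(* The field of coefficients Q(a, b), and the field Q(a, b)(q). *)
Definition coeffs : fieldType := {fraction {poly {poly rat}}}.
Definition ratfuns : fieldType := {fraction {poly coeffs}}.

Definition inda : ratfuns :=
  tofrac (polyC (tofrac (polyC 'X : {poly {poly rat}}) : coeffs)).
Definition indb : ratfuns :=
  tofrac (polyC (tofrac ('X : {poly {poly rat}}) : coeffs)).
Definition indq : ratfuns := tofrac ('X : {poly coeffs}).

(* Main.v *)
Require Import Defs.
From mathcomp Require Import all_boot all_order all_algebra all_field.
From mathcomp Require Import ring zify.

(* Put p = q^d. The summand is very-well-poised, so it makes sense to replace q
   by a parameter A in it, and the last of the six well-poised pairs by one with
   a parameter c. Let m divide n, m > 1, and choose r < m with dr = -1 modulo m.
   When A = p^-r the terms k and r - k cancel, for every c, and p^-r is congruent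
   to q modulo Phi_m. Splitting the sum into blocks of length m, this gives the
   congruence modulo Phi_m, hence modulo [n].

   If n = -1 modulo d, take m = n and r = n - (n + 1) / d, so that c = q p^r is
   congruent to 1 modulo Phi_n. Let T(A, c) be the sum up to n - 1. The mixed
   difference T(q, 1) - T(q, c) - T(p^-r, 1) + T(p^-r, c) is divisible by
   Phi_n^2, and the last two terms vanish, so one may replace T(q, 1) by T(q, c).
   The latter is a terminating 8phi7 series, and Watson's transformation (obtained
   by expanding one pair with the q-Saalschuetz sum and then summing a 6phi5)
   writes it as a sum whose terms all have the factors (q;p)_{r+j+1} and
   (p/q;p)_j (p/q;p)_{r-j}, each of which is divisible by Phi_n. *)

Set Implicit Arguments.
Unset Strict Implicit.
Unset Printing Implicit Defensive.

Import GRing.Theory.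
Local Open Scope ring_scope.

(** * Terminating basic hypergeometric sums *)

Section QPoch.

Variable F : fieldType.
Implicit Types (x y z p : F).

Lemma qpoch0 x p : qpoch x p 0 = 1.
Proof. by rewrite /qpoch big_ord0. Qed.

Lemma qpochS x p k : qpoch x p k.+1 = qpoch x p k * (1 - x * p ^+ k).
Proof. by rewrite /qpoch big_ord_recr. Qed.

Lemma qpochD x p k l : qpoch x p (k + l) = qpoch x p k * qpoch (x * p ^+ k) p l.
Proof.
elim: l => [|l IH]; first by rewrite addn0 qpoch0 mulr1.
by rewrite addnS !qpochS IH exprD; ring.
Qed.

Lemma qpochS_head x p k : qpoch x p k.+1 = (1 - x) * qpoch (x * p) p k.
Proof. by rewrite -add1n qpochD qpochS qpoch0 expr0 expr1 mul1r mulr1. Qed.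

Lemma qpoch_neq0 x p k :
  (forall j, (j < k)%N -> 1 - x * p ^+ j != 0) -> qpoch x p k != 0.
Proof. by move=> h; apply/prodf_neq0 => i _; apply: h. Qed.

End QPoch.

Section Summations.

Variable F : fieldType.
Variable p : F.
Implicit Types A x y z b c : F.
Hypothesis p0 : p != 0.
Hypothesis p1 : forall s, 1 - p ^+ s.+1 != 0.
Local Notation "[ x ]_ k" := (qpoch x p k) (at level 2, k at level 2, format "[ x ]_ k").

(** Brings the nonvanishing of a factor containing a fraction to the cleared form in which [field]
    asks for it. *)
Lemma clear_denom (u v w : F) : v != 0 -> 1 - u / v * w != 0 -> v - u * w != 0.
Proof.
move=> v0; apply: contraNneq => /eqP; rewrite subr_eq0 => /eqP e.
by rewrite mulrAC -e divff // subrr.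
Qed.

Lemma clear_denom1 (u v : F) : v != 0 -> 1 - u / v != 0 -> v - u != 0.
Proof. by move=> v0 h; have := @clear_denom u v 1 v0; rewrite !mulr1; apply. Qed.

Lemma qpochp_neq0 k : [p]_k != 0.
Proof. by apply: qpoch_neq0 => j _; rewrite -exprS. Qed.

(** * The terminating very-well-poised 6phi5 sum *)

Definition phi65_term A x y z k :=
  (1 - A * p ^+ (2 * k)) * ([A]_k * [x]_k * [y]_k * [z]_k)
  / ([p]_k * [A * p / x]_k * [A * p / y]_k * [A * p / z]_k)
  * (A * p / (x * y * z)) ^+ k.

(* The certificate of the telescoping (Wilf-Zeilberger) proof, shifted by one. *)
Definition phi65_cert A x y z k :=
  ([A]_k.+1 * [x]_k.+1 * [y]_k.+1 * [z]_k)
  / ([p]_k * [A * p / x]_k * [A * p / y]_k * [A * p / z * p]_k)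
  * (A * p / (x * y * z)) ^+ k.+1.

(** A relation between the series at [z] and at [z / p]: the combination of the terms of index
    [k + 1] is the increment of the certificate. At [z = p^-N] the certificate vanishes for [k > N],
    which leaves a recurrence in [N]. *)
Lemma phi65_telescope A x y z k : x != 0 -> y != 0 -> z != 0 ->
  (forall s, 1 - A * p / x * p ^+ s != 0) ->
  (forall s, 1 - A * p / y * p ^+ s != 0) ->
  (forall s, 1 - A * p / z * p ^+ s != 0) ->
  (1 - A * p / (x * z)) * (1 - A * p / (y * z))
    * \sum_(i < k.+1) phi65_term A x y (z / p) i
  - (1 - A * p / z) * (1 - A * p / (x * y * z))
    * \sum_(i < k.+1) phi65_term A x y z i
  = phi65_cert A x y z k.
Proof.
move=> x0 y0 z0 hx hy hz; elim: k => [|k IH].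
  rewrite !big_ord1 /phi65_term /phi65_cert !qpochS !qpoch0 muln0 !expr0 expr1.
  by field; rewrite x0 y0 z0 oner_neq0.
rewrite ![\sum_(i < k.+2) _]big_ord_recr /=.
have -> (u v a b c d : F) : a * (u + c) - b * (v + d)
   = (a * u - b * v) + (a * c - b * d) by ring.
rewrite {}IH /phi65_term /phi65_cert.
have Dp : A * p / (z / p) = A * p / z * p by field; rewrite z0 p0.
rewrite !Dp.
rewrite (qpochS_head (z / p)) divfK // (qpochS_head (A * p / z)).
have -> : A * p / (x * y * (z / p)) = A * p / (x * y * z) * p.
  by field; rewrite x0 y0 z0 p0.
rewrite [(_ * p) ^+ k.+1]exprMn (exprS _ k.+1) mulnC exprM (exprS p) !qpochS.
have := hz 0%N; rewrite expr0 mulr1 => hz0.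
have := hz k.+1; rewrite exprS => hzk.
have dz : [A * p / z * p]_k != 0.
  by apply: qpoch_neq0 => j _; rewrite -mulrA -exprS.
have dx : [A * p / x]_k != 0 by apply: qpoch_neq0.
have dy : [A * p / y]_k != 0 by apply: qpoch_neq0.
have dp := qpochp_neq0 k.
have hxk := hx k; have hyk := hy k; have := p1 k; rewrite exprS => hpk.
set K := p ^+ k in hxk hyk hzk hpk *.
set E := (A * p / (x * y * z)) ^+ k.+1.
move: dz dx dy dp.
move: [A * p / z * p]_k [A * p / x]_k [A * p / y]_k [p]_k [z]_k => dz dx dy dp cz.
move: [A]_k [x]_k [y]_k E => cA cx cy E dz0 dx0 dy0 dp0.
field.
rewrite x0 y0 z0 p0 dz0 dx0 dy0 dp0 hpk.
by rewrite (clear_denom x0 hxk) (clear_denom y0 hyk) -(mulrA _ p K) (clear_denom z0 hzk)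
  (clear_denom1 z0 hz0).
Qed.

Lemma qpoch_pVn0 N k : (N < k)%N -> [p ^- N]_k = 0.
Proof.
move=> lt_Nk; rewrite /qpoch (bigD1 (Ordinal lt_Nk)) //= mulVf ?subrr ?mul0r //.
by rewrite expf_neq0.
Qed.

(** Induction on [N] by the contiguous relation at [z = p^-N]. The factor [[A]_N.+1] appears because
    the terms are not divided by [1 - A]. *)
Lemma phi65_sum A x y N : x != 0 -> y != 0 ->
  (forall s, 1 - A * p * p ^+ s != 0) ->
  (forall s, 1 - A * p / x * p ^+ s != 0) ->
  (forall s, 1 - A * p / y * p ^+ s != 0) ->
  \sum_(i < N.+1) phi65_term A x y (p ^- N) i
  = [A]_N.+1 * [A * p / (x * y)]_N / ([A * p / x]_N * [A * p / y]_N).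
Proof.
move=> x0 y0 hA hx hy; elim: N => [|N IH].
  by rewrite big_ord1 /phi65_term !qpochS !qpoch0 muln0 !(expr0, mulr1, mul1r, invr1).
have z0 : p ^- N != 0 by rewrite invr_neq0 ?expf_neq0.
have hz s : 1 - A * p / p ^- N * p ^+ s != 0 by rewrite invrK -mulrA -exprD.
(* This zero term lets both sums of the relation run to [N + 1]. *)
have t0 : phi65_term A x y (p ^- N) N.+1 = 0.
  by rewrite /phi65_term qpoch_pVn0 // !(mulr0, mul0r).
have := phi65_telescope N.+1 x0 y0 z0 hx hy hz.
rewrite /phi65_cert (qpoch_pVn0 (ltnSn N)) mulr0 mul0r mul0r.
rewrite [X in _ - _ * X]big_ord_recr /= t0 addr0 {}IH => /eqP; rewrite subr_eq0 => /eqP E.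
have -> : p ^- N.+1 = p ^- N / p by rewrite exprS invfM mulrC.
have nx := hx N; have ny := hy N.
have dx : [A * p / x]_N != 0 by apply: qpoch_neq0.
have dy : [A * p / y]_N != 0 by apply: qpoch_neq0.
(* At [z = p^-N] these are the factors of index [N] of the two denominators, so the relation can be
   solved for the next sum. *)
have a0 : (1 - A * p / (x * p ^- N)) * (1 - A * p / (y * p ^- N)) != 0.
  by rewrite !invfM !invrK !mulrA mulf_neq0.
apply: (mulfI a0); rewrite {}E ![in RHS]qpochS -!qpochS.
rewrite [in RHS]qpochS [[A * p / (x * y)]_N.+1]qpochS [[A * p / x]_N.+1]qpochS.
rewrite [[A * p / y]_N.+1]qpochS exprS.
have pN0 : p ^+ N != 0 by rewrite expf_neq0.
move: [A]_N.+1 [A * p / (x * y)]_N [A * p / x]_N [A * p / y]_N dx dy => u v dx dy dx0 dy0.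
move: (p ^+ N) nx ny pN0 => K nx ny K0.
by field; rewrite x0 y0 oner_neq0 K0 dx0 dy0 (clear_denom x0 nx) (clear_denom y0 ny).
Qed.

(** * The q-Saalschuetz sum *)

Definition phi32_term A b c y k :=
  ([y]_k * [A / y]_k * [A * p / (b * c)]_k)
  / ([p]_k * [A * p / b]_k * [A * p / c]_k) * p ^+ k.

Definition phi32_cert A b c y k :=
  (y ^+ 2 - A * p) * ([y]_k * [A * p / y]_k * [A * p / (b * c)]_k.+1)
  / ([p]_k * [A * p / b]_k * [A * p / c]_k).

(** The same method as for the 6phi5, now with the step from [y] to [y / p]; the partner [A / y]
    becomes [A p / y]. *)
Lemma phi32_telescope A b c y k : b != 0 -> c != 0 -> y != 0 ->
  (forall s, 1 - A * p / b * p ^+ s != 0) ->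
  (forall s, 1 - A * p / c * p ^+ s != 0) ->
  (y - A * p / b) * (y - A * p / c)
    * \sum_(i < k.+1) phi32_term A b c (y / p) i
  - A * p / (b * c) * (y - b) * (y - c)
    * \sum_(i < k.+1) phi32_term A b c y i
  = phi32_cert A b c y k.
Proof.
move=> b0 c0 y0 hb hc; elim: k => [|k IH].
  rewrite !big_ord1 /phi32_term /phi32_cert !qpochS !qpoch0 !expr0.
  by field; rewrite b0 c0 oner_neq0.
rewrite ![\sum_(i < k.+2) _]big_ord_recr /=.
have -> (u v a e f g : F) : a * (u + f) - e * (v + g)
   = (a * u - e * v) + (a * f - e * g) by ring.
rewrite {}IH /phi32_term /phi32_cert.
have Dp : A / (y / p) = A * p / y by field; rewrite y0 p0.
have Ep : A / y * p = A * p / y by rewrite mulrAC.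
rewrite !Dp (qpochS_head (y / p)) divfK // (qpochS_head (A / y)) Ep.
rewrite (exprS p) !qpochS.
have dx : [A * p / b]_k != 0 by apply: qpoch_neq0.
have dy : [A * p / c]_k != 0 by apply: qpoch_neq0.
have dp := qpochp_neq0 k.
have hbk := hb k; have hck := hc k; have := p1 k; rewrite exprS => hpk.
move: dx dy dp.
move: [A * p / b]_k [A * p / c]_k [p]_k [A * p / (b * c)]_k => dx dy dp cz.
move: [A * p / y]_k [y]_k => cx cy.
move: (p ^+ k) hbk hck hpk => K hbk hck hpk dx0 dy0 dp0.
field.
by rewrite b0 c0 y0 p0 dx0 dy0 dp0 hpk (clear_denom b0 hbk) (clear_denom c0 hck).
Qed.

(** The series is the balanced 3phi2 with upper parameters [y], [A / y], [A p / (b c)]. It is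
    parametrised so that its value at [y = p^-k] is what the pair [b], [c] contributes to the term
    of index [k] of a well-poised series in [A]. *)
Lemma q_saalschutz A b c k : b != 0 -> c != 0 ->
  (forall s, 1 - A * p / b * p ^+ s != 0) ->
  (forall s, 1 - A * p / c * p ^+ s != 0) ->
  \sum_(i < k.+1) phi32_term A b c (p ^- k) i
  = [b]_k * [c]_k / ([A * p / b]_k * [A * p / c]_k) * (A * p / (b * c)) ^+ k.
Proof.
move=> b0 c0 hb hc; elim: k => [|k IH].
  by rewrite big_ord1 /phi32_term !qpoch0 !(expr0, mulr1, mul1r, invr1).
have y0 : p ^- k != 0 by rewrite invr_neq0 ?expf_neq0.
have t0 : phi32_term A b c (p ^- k) k.+1 = 0.
  by rewrite /phi32_term qpoch_pVn0 // !(mulr0, mul0r).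
have := phi32_telescope k.+1 b0 c0 y0 hb hc.
rewrite /phi32_cert (qpoch_pVn0 (ltnSn k)) !(mulr0, mul0r).
rewrite [X in _ - _ * X]big_ord_recr /= t0 addr0 {}IH => /eqP; rewrite subr_eq0 => /eqP E.
have -> : p ^- k.+1 = p ^- k / p by rewrite exprS invfM mulrC.
have nb := hb k; have nc := hc k.
have db : [A * p / b]_k != 0 by apply: qpoch_neq0.
have dc : [A * p / c]_k != 0 by apply: qpoch_neq0.
have pk0 : p ^+ k != 0 by rewrite expf_neq0.
have a0 : (p ^- k - A * p / b) * (p ^- k - A * p / c) != 0.
  have -> (u : F) : p ^- k - u = p ^- k * (1 - u * p ^+ k).
    by rewrite mulrBr mulr1 mulrCA mulVf // mulr1.
  have -> (u : F) : p ^- k - u = p ^- k * (1 - u * p ^+ k).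
    by rewrite mulrBr mulr1 mulrCA mulVf // mulr1.
  by rewrite !mulf_neq0.
apply: (mulfI a0); rewrite {}E !qpochS [(_ / _) ^+ k.+1]exprS.
move: ((_ / _) ^+ k) => E.
move: [b]_k [c]_k [A * p / b]_k [A * p / c]_k db dc => u v dx dy dx0 dy0.
move: (p ^+ k) nb nc pk0 => K nb nc K0.
by field; rewrite b0 c0 ?oner_neq0 K0 dx0 dy0 (clear_denom b0 nb) (clear_denom c0 nc).
Qed.

(** * Watson's transformation *)

Definition pochV_coef j := \prod_(t < j) - p ^- t.+1.

(** Reversal of (p^-n;p)_j for n = j + i. Here [pochV_coef j] is (-1)^j p^(-j(j+1)/2), written as a
    product to avoid the halved exponent. *)
Lemma qpoch_pVn i j :
  [p ^- (j + i)]_j * [p]_i = pochV_coef j * p ^- (i * j) * [p]_(j + i).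
Proof.
rewrite /pochV_coef; elim: j => [|j IH].
  by rewrite big_ord0 qpoch0 muln0 expr0 invr1 !mul1r.
have pn0 n : p ^+ n != 0 by rewrite expf_neq0.
rewrite qpochS_head addSn.
have -> : p ^- (j + i).+1 * p = p ^- (j + i).
  by rewrite exprS invfM mulrAC mulVf // mul1r.
rewrite -[_ * _ * [p]_i]mulrA IH big_ord_recr /= qpochS -exprS mulnS exprD !exprS exprD.
move: (\prod_(t < j) _) [p]_(j + i) (p ^+ (i * j)) (pn0 (i * j)%N) => u v w w0.
move: (p ^+ i) (pn0 i) (p ^+ j) (pn0 j) => I I0 J J0.
by field; rewrite I0 J0 p0 w0.
Qed.

Definition phi65_coef A x y z j :=
  pochV_coef j * (A * p / (x * y * z)) ^+ j * ([x]_j * [y]_j * [z]_j * [A]_(j + j))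
  / ([A * p / x]_j * [A * p / y]_j * [A * p / z]_j).

(** The weight turns (A;p)_(j+i) into (A;p)_(i+2j) and (p;p)_(j+i) into (p;p)_i. The power p^-(ij)
    left by the reversal fits the new argument, since [x y z] gains p^(3j) but [A] only p^(2j). *)
Lemma phi65_term_shift A x y z i j :
  phi65_term A x y z (j + i) * ([p ^- (j + i)]_j * [A / p ^- (j + i)]_j)
  = phi65_coef A x y z j
    * phi65_term (A * p ^+ (j + j)) (x * p ^+ j) (y * p ^+ j) (z * p ^+ j) i.
Proof.
have J0 : p ^+ j != 0 by rewrite expf_neq0.
have shift u : A * p ^+ (j + j) * p / (u * p ^+ j) = A * p / u * p ^+ j.
  rewrite exprD invfM; move: (u^-1) (p ^+ j) J0 => v J J1.
  by field.
have e : [p ^- (j + i)]_j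
   = pochV_coef j * p ^- (i * j) * [p]_(j + i) / [p]_i.
  by rewrite -qpoch_pVn mulfK // qpochp_neq0.
have eA : [A * p ^+ (j + i)]_j * [A]_(j + i) = [A]_(j + j) * [A * p ^+ (j + j)]_i.
  by rewrite mulrC -!qpochD addnAC.
have eW : A * p ^+ (j + j) * p / (x * p ^+ j * (y * p ^+ j) * (z * p ^+ j))
    = A * p / (x * y * z) * p ^- j.
  rewrite exprD !invfM; move: (x^-1) (y^-1) (z^-1) (p ^+ j) J0 => x' y' z' J J1.
  by field.
rewrite /phi65_term /phi65_coef !shift {}e eW invrK.
rewrite (qpochD x) (qpochD y) (qpochD z) !(qpochD (_ / _)).
have -> : p ^+ (2 * (j + i)) = p ^+ (j + j) * p ^+ (2 * i).
  by rewrite -exprD; congr (_ ^+ _); lia.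
move: (A * p / (x * y * z)) => W.
rewrite (exprD W) exprMn exprVn -exprM [(j * i)%N]mulnC.
have dp := qpochp_neq0 (j + i).
rewrite !invfM; have := divff dp.
move: ([p]_(j + i)) ([p]_(j + i))^-1 => P P' PP.
move: ([A * p / x]_j)^-1 ([A * p / x * p ^+ j]_i)^-1 => X1 X2.
move: ([A * p / y]_j)^-1 ([A * p / y * p ^+ j]_i)^-1 => Y1 Y2.
move: ([A * p / z]_j)^-1 ([A * p / z * p ^+ j]_i)^-1 ([p]_i)^-1 => Z1 Z2 pi.
move: [x]_j [x * p ^+ j]_i [y]_j [y * p ^+ j]_i [z]_j [z * p ^+ j]_i.
move=> x1 x2 y1 y2 z1 z2.
move: eA; move: [A]_(j + i) [A * p ^+ (j + i)]_j [A]_(j + j) [A * p ^+ (j + j)]_i.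
move=> a1 a2 a3 a4 eA.
move: (p ^- (i * j)) (W ^+ i) (W ^+ j) (pochV_coef j) (p ^+ (j + j)) => I Wi Wj k J2.
move: (p ^+ (2 * i)) => I2.
by ring: eA PP.
Qed.

(** The factor [[p ^- k]_j] kills the terms with [k < j]; the others form a 6phi5 terminated by p^-N
    p^j = p^-(N-j). *)
Lemma phi65_sum_shift A x y N j : (j <= N)%N -> x != 0 -> y != 0 ->
  (forall s, 1 - A * p * p ^+ s != 0) ->
  (forall s, 1 - A * p / x * p ^+ s != 0) ->
  (forall s, 1 - A * p / y * p ^+ s != 0) ->
  \sum_(k < N.+1) phi65_term A x y (p ^- N) k * ([p ^- k]_j * [A / p ^- k]_j)
  = phi65_coef A x y (p ^- N) j
    * ([A * p ^+ (j + j)]_(N - j).+1 * [A * p / (x * y)]_(N - j)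
       / ([A * p / x * p ^+ j]_(N - j) * [A * p / y * p ^+ j]_(N - j))).
Proof.
move=> le_jN x0 y0 hA hx hy.
have J0 : p ^+ j != 0 by rewrite expf_neq0.
have shift u : A * p ^+ (j + j) * p / (u * p ^+ j) = A * p / u * p ^+ j.
  rewrite exprD invfM; move: (u^-1) (p ^+ j) J0 => v J J1.
  by field.
have shift2 : A * p ^+ (j + j) * p / (x * p ^+ j * (y * p ^+ j)) = A * p / (x * y).
  rewrite exprD !invfM; move: (x^-1) (y^-1) (p ^+ j) J0 => x' y' J J1.
  by field.
have := @phi65_sum (A * p ^+ (j + j)) (x * p ^+ j) (y * p ^+ j) (N - j).
rewrite !shift shift2 => <-.
- rewrite -(big_mkord predT 
    (fun k => phi65_term A x y (p ^- N) k * ([p ^- k]_j * [A / p ^- k]_j))).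
  rewrite (@big_cat_nat _ _ _ j) //=; last exact: leqW.
  rewrite big_nat big1 ?add0r; last first.
    by move=> k /andP[_ lt_kj]; rewrite qpoch_pVn0 // mul0r mulr0.
  rewrite -{1}[j]add0n big_addn big_mkord subSn // mulr_sumr.
  have -> : p ^- (N - j) = p ^- N * p ^+ j.
    by rewrite -{2}(subnK le_jN) exprD invfM divfK.
  by apply: eq_bigr => i _; rewrite addnC phi65_term_shift.
- by rewrite mulf_neq0.
- by rewrite mulf_neq0.
- by move=> s; rewrite [A * _ * p]mulrAC -[A * p * _ * _]mulrA -exprD.
- by move=> s; rewrite -mulrA -exprD.
- by move=> s; rewrite -mulrA -exprD.
Qed.

Lemma watson_sum A x y b c N : x != 0 -> y != 0 -> b != 0 -> c != 0 ->
  (forall s, 1 - A * p * p ^+ s != 0) ->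
  (forall s, 1 - A * p / x * p ^+ s != 0) ->
  (forall s, 1 - A * p / y * p ^+ s != 0) ->
  (forall s, 1 - A * p / b * p ^+ s != 0) ->
  (forall s, 1 - A * p / c * p ^+ s != 0) ->
  \sum_(k < N.+1) phi65_term A x y (p ^- N) k
    * ([b]_k * [c]_k / ([A * p / b]_k * [A * p / c]_k) * (A * p / (b * c)) ^+ k)
  = \sum_(j < N.+1) [A * p / (b * c)]_j
      / ([p]_j * [A * p / b]_j * [A * p / c]_j) * p ^+ j
    * (phi65_coef A x y (p ^- N) j
       * ([A * p ^+ (j + j)]_(N - j).+1 * [A * p / (x * y)]_(N - j)
          / ([A * p / x * p ^+ j]_(N - j) * [A * p / y * p ^+ j]_(N - j)))).
Proof.
move=> x0 y0 b0 c0 hA hx hy hb hc.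
transitivity (\sum_(k < N.+1) \sum_(j < N.+1)
   phi65_term A x y (p ^- N) k * phi32_term A b c (p ^- k) j).
  apply: eq_bigr => k _; rewrite -mulr_sumr -q_saalschutz //; congr (_ * _).
  (* Terms with [j > k] vanish, so the inner range can be made independent of [k] before the
     exchange of sums. *)
  rewrite (big_ord_widen N.+1 (phi32_term A b c (p ^- k))) // big_mkcond.
  apply: eq_bigr => j _; case: ifPn => //; rewrite -leqNgt => lt_kj.
  by rewrite /phi32_term qpoch_pVn0 // !mul0r.
rewrite exchange_big; apply: eq_bigr => j _.
have le_jN : (j <= N)%N by rewrite -ltnS.
rewrite -(phi65_sum_shift le_jN x0 y0 hA hx hy) mulr_sumr.
apply: eq_bigr => k _; rewrite /phi32_term; move: (phi65_term _ _ _ _ _) => t.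
move: ([p]_j * _ * _) => u; ring.
Qed.

End Summations.

(** * The summand and its antisymmetry *)

Section Summand.

Variables (F : fieldType) (a b p : F).
Implicit Types A c e y : F.

(** For [e = 1] this is y^k (A/y;p)_k / (yp;p)_k, the well-poised pair of the parameter [A / y].
    Including the power of [y] keeps the argument p^2 / A^3 of the series free of [a], [b] and
    [c]. *)
Definition vwp_ratio A e y k :=
  \prod_(j < k) ((y - A * e * p ^+ j) / (1 - y * e * p ^+ j.+1)).

(* Up to the factor 1 / (1 - q), the summand of the theorem is the case
   A = q, e = c = 1; the factor e stands for a power of p by which the sum is
   shifted. *)
Definition vwp_term A e c k :=
  (1 - A * e ^+ 2 * p ^+ (2 * k)) * (p ^+ 2 / A ^+ 3) ^+ k
  * (vwp_ratio A e a k * vwp_ratio A e a^-1 k * vwp_ratio A e b k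
     * vwp_ratio A e b^-1 k * vwp_ratio A e 1 k * vwp_ratio A e c k).

Lemma vwp_ratioS A e y k :
  vwp_ratio A e y k.+1
  = vwp_ratio A e y k * ((y - A * e * p ^+ k) / (1 - y * e * p ^+ k.+1)).
Proof. by rewrite /vwp_ratio big_ord_recr. Qed.

Lemma vwp_ratioD A e y k l :
  vwp_ratio A e y (k + l) = vwp_ratio A e y k * vwp_ratio A (e * p ^+ k) y l.
Proof.
elim: l => [|l IH]; first by rewrite addn0 /vwp_ratio big_ord0 mulr1.
rewrite addnS !vwp_ratioS IH -mulrA -addnS !exprD !mulrA.
by congr (_ * _); congr (_ * _); rewrite ?[_ * p ^+ k * p ^+ l.+1]mulrAC.
Qed.

Section Antisymmetry.

Variables (A : F) (r : nat).
Hypothesis p0 : p != 0.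
Hypothesis Ar : A * p ^+ r = 1.

Definition neg_geom k := \prod_(j < k) - (A * p ^+ j).

(** As A = p^-r, one has y - A p^j = -A p^j (1 - y p^(r-j)). Up to [neg_geom] the ratio is thus an
    analogue of a q-binomial coefficient, symmetric in [k] and [r - k]. *)
Lemma vwp_ratio_sym y k : (k <= r)%N ->
  (forall s, (s < r)%N -> 1 - y * p ^+ s.+1 != 0) ->
  vwp_ratio A 1 y k
  = neg_geom k * (qpoch (y * p) p r / (qpoch (y * p) p (r - k) * qpoch (y * p) p k)).
Proof.
move=> + hy; have nz k1 : (k1 <= r)%N -> qpoch (y * p) p k1 != 0.
  move=> le_kr; apply: qpoch_neq0 => j lt_jk; rewrite -mulrA -exprS.
  by rewrite hy // (leq_trans lt_jk).
elim: k => [|k IH] lt_kr.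
  rewrite /vwp_ratio /neg_geom !big_ord0 subn0 qpoch0 mulr1 mul1r divff //.
  exact: nz.
rewrite vwp_ratioS IH ?mulr1; last exact: ltnW.
rewrite /neg_geom big_ord_recr /= qpochS ?mulr1.
have -> : y - A * p ^+ k = - (A * p ^+ k) * (1 - y * p ^+ (r - k)).
  have e : A * p ^+ k * p ^+ (r - k) = 1 by rewrite -mulrA -exprD subnKC // ltnW.
  ring: e.
have rk : (r - k = (r - k.+1).+1)%N by lia.
have : 1 - y * p ^+ (r - k) != 0 by rewrite rk hy //; lia.
have := nz _ (ltnW lt_kr); have := nz _ (leq_subr k.+1 r).
have := hy _ lt_kr; rewrite rk qpochS ?mulr1 -!(mulrA y p) -!exprS.
move: (1 - y * p ^+ _) (1 - y * p ^+ _) => h1 h2.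
move: (qpoch _ _ r) (qpoch _ _ _) (qpoch _ _ k) => u v w.
move: (\prod_(i < k) _) (A * p ^+ k) => x z h10 v0 w0 h20.
by field; rewrite h10 v0 w0 h20.
Qed.

(** [neg_geom k] is (-A)^k p^(k(k-1)/2); squaring it avoids the halved exponent. *)
Lemma neg_geom_sqr k : neg_geom k ^+ 2 * p ^+ k = A ^+ (2 * k) * p ^+ (k * k).
Proof.
rewrite /neg_geom; elim: k => [|k IH]; first by rewrite big_ord0 expr1n mulr1.
rewrite big_ord_recr /= exprMn sqrrN [p ^+ k.+1]exprS.
have -> : (k.+1 * k.+1 = k * k + k + k + 1)%N by lia.
have -> : (2 * k.+1 = 2 * k + 2)%N by lia.
rewrite [A ^+ (_ + 2)]exprD !(exprD p).
move: (\prod_(j < k) _) (p ^+ k) (A ^+ (2 * k)) (p ^+ (k * k)) IH => t u v w e.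
ring: e.
Qed.

(** The part 3kk' of the exponent is symmetric, so only p^-k distinguishes [k] from [k']. *)
Lemma vwp_power k k' : (k + k' = r)%N ->
  (p ^+ 2 / A ^+ 3) ^+ k * neg_geom k ^+ 6 = p ^- (3 * (k * k') + k).
Proof.
move=> def_r; have pn0 n : p ^+ n != 0 by rewrite expf_neq0.
have A0 : A != 0 by apply: contra_eqN Ar => /eqP ->; rewrite mul0r eq_sym oner_neq0.
have e1 : A ^+ k * p ^+ (k * k) * p ^+ (k * k') = 1.
  by rewrite -mulrA -exprD -mulnDr def_r mulnC exprM -exprMn Ar expr1n.
apply: (mulIf (pn0 (3 * (k * k') + k)%N)); rewrite mulVf //.
have -> : (p ^+ 2 / A ^+ 3) ^+ k = p ^+ k ^+ 2 / A ^+ k ^+ 3.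
  by rewrite expr_div_n -!exprM ![(k * _)%N]mulnC.
have -> : p ^+ (3 * (k * k') + k) = p ^+ (k * k') ^+ 3 * p ^+ k.
  by rewrite exprD -exprM [(_ * 3)%N]mulnC.
have := neg_geom_sqr k; rewrite [(2 * k)%N]mulnC exprM.
have: A ^+ k != 0 by rewrite expf_neq0.
move: (A ^+ k) (neg_geom k) (p ^+ k) (p ^+ (k * k)) (p ^+ (k * k')) e1.
move=> u e P v w e1 u0 e2.
(* The expression is a cube, and its root is [u * v * w = 1] by [e2] and [e1]. *)
transitivity ((e ^+ 2 * P * w / u) ^+ 3); first by field.
rewrite e2 -[RHS](expr1n _ 3) -e1; congr (_ ^+ 3); by field.
Qed.

(** Apart from symmetric factors there remains (1 - A p^(2k)) p^-k = p^-k - p^-(r-k), which is odd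
    under the exchange of [k] and [r - k]. *)
Lemma vwp_term_sym c k :
  (k <= r)%N -> 
  (forall y s, y \in [:: a; a^-1; b; b^-1; 1; c] -> 1 - y * p ^+ s.+1 != 0) ->
  vwp_term A 1 c (r - k) = - vwp_term A 1 c k.
Proof.
move=> le_kr hy; have e1 : (k + (r - k) = r)%N by rewrite subnKC.
have e2 : (r - k + k = r)%N by rewrite subnK.
have R y : y \in [:: a; a^-1; b; b^-1; 1; c] -> exists2 B,
    vwp_ratio A 1 y k = neg_geom k * B & vwp_ratio A 1 y (r - k) = neg_geom (r - k) * B.
  move=> hin; eexists; first by apply: vwp_ratio_sym => // s _; apply: hy.
  rewrite vwp_ratio_sym ?leq_subr // => [|s _]; last exact: hy.
  by rewrite subKn // [qpoch _ _ k * _]mulrC.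
rewrite /vwp_term.
have [|B1 -> ->] := R a; first by rewrite !inE eqxx ?orbT.
have [|B2 -> ->] := R a^-1; first by rewrite !inE eqxx ?orbT.
have [|B3 -> ->] := R b; first by rewrite !inE eqxx ?orbT.
have [|B4 -> ->] := R b^-1; first by rewrite !inE eqxx ?orbT.
have [|B5 -> ->] := R 1; first by rewrite !inE eqxx ?orbT.
have [|B6 -> ->] := R c; first by rewrite !inE eqxx ?orbT.
have split (u v e : F) : u * v * (e * B1 * (e * B2) * (e * B3) * (e * B4)
    * (e * B5) * (e * B6)) = u * (v * e ^+ 6) * (B1 * B2 * B3 * B4 * B5 * B6) by ring.
rewrite !split (vwp_power e1) (vwp_power e2). 
rewrite -[RHS]mulNr; congr (_ * _).
have pow n : p ^- (3 * (k * (r - k)) + n) = p ^- (3 * (k * (r - k))) * p ^- n.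
  by rewrite exprD invfM.
rewrite [((r - k) * k)%N]mulnC !pow ![_ * (p ^- (3 * _) * _)]mulrCA -[RHS]mulrN.
congr (_ * _).
have pn0 n : p ^+ n != 0 by rewrite expf_neq0.
have hk : A * p ^+ k * p ^+ (r - k) = 1 by rewrite -mulrA -exprD e1.
rewrite expr1n mulr1.
rewrite [(2 * k)%N]mulnC [(2 * _)%N]mulnC !exprM.
move: (p ^+ k) (p ^+ (r - k)) (pn0 k) (pn0 (r - k)%N) hk => P Q P0 Q0 hk.
have -> : A = P^-1 / Q by apply: (mulIf Q0); apply: (mulIf P0); rewrite divfK // mulVf // mulrAC.
by field; rewrite P0 Q0.
Qed.

(** Reversing the order of summation shows that twice the sum up to [r] is zero. Beyond [r] the
    ratio with [y = 1] contains the factor 1 - A p^r = 0. *)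
Lemma vwp_antisym_sum c : 2%:R != 0 :> F ->
  (forall y s, y \in [:: a; a^-1; b; b^-1; 1; c] -> 1 - y * p ^+ s.+1 != 0) ->
  forall m, (r < m)%N -> \sum_(k < m) vwp_term A 1 c k = 0.
Proof.
move=> nz2 hy m lt_rm.
have A0 : A != 0 by apply: contra_eqN Ar => /eqP ->; rewrite mul0r eq_sym oner_neq0.
rewrite -(big_mkord predT (vwp_term A 1 c)) (@big_cat_nat _ _ _ r.+1) //=.
rewrite [X in _ + X]big_nat [X in _ + X]big1 ?addr0; last first.
  move=> k /andP[lt_rk _]; rewrite /vwp_term.
  have -> : vwp_ratio A 1 1 k = 0; last by rewrite !(mulr0, mul0r).
  rewrite /vwp_ratio (bigD1 (Ordinal lt_rk)) //= mulr1 Ar subrr.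
  by rewrite !mul0r.
rewrite big_mkord; apply: (mulfI nz2); rewrite mulr0 mulrDl mul1r.
rewrite {1}(reindex_inj rev_ord_inj) /= -big_split big1 // => i _ /=.
by rewrite subSS vwp_term_sym // ?addNr // -ltnS.
Qed.

End Antisymmetry.
End Summand.

(** * Congruences in a subring of a field *)

(** A subring given as a predicate: quotients are formed in the ambient field, and only their
    membership has to be checked. *)
Record subring_prop (F : fieldType) (O : F -> Prop) : Prop := SubringProp {
  srp1 : O 1;
  srpB : forall x y, O x -> O y -> O (x - y);
  srpM : forall x y, O x -> O y -> O (x * y) }.

Section Congruences.

Variables (F : fieldType) (O : F -> Prop) (pi : F).
Implicit Types x y e : F.
Hypothesis OR : subring_prop O.
Hypothesis Opi : O pi.

Lemma O1 : O 1. Proof. exact: srp1 OR. Qed.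
Lemma O0 : O 0. Proof. by rewrite -(subrr 1); apply: (srpB OR); apply: O1. Qed.
Lemma ON x : O x -> O (- x). Proof. by rewrite -sub0r; apply: (srpB OR) O0. Qed.
Lemma OM x y : O x -> O y -> O (x * y). Proof. exact: (srpM OR). Qed.
Lemma OB x y : O x -> O y -> O (x - y). Proof. exact: (srpB OR). Qed.
Lemma OD x y : O x -> O y -> O (x + y).
Proof. by move=> Ox Oy; rewrite -(opprK y); apply/OB/ON. Qed.
Lemma OX x k : O x -> O (x ^+ k).
Proof. by move=> Ox; elim: k => [|k IH]; [apply: O1 | rewrite exprS; apply: OM]. Qed.
Lemma Oprod I (s : seq I) (P : pred I) (f : I -> F) :
  (forall i, P i -> O (f i)) -> O (\prod_(i <- s | P i) f i).
Proof. by move=> h; elim/big_ind: _ => //; [apply: O1 | apply: OM]. Qed.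

Definition Ounit x := [/\ x != 0, O x & O x^-1].

Lemma OunitV x : Ounit x -> Ounit x^-1.
Proof. by case=> x0 Ox Oxi; split; rewrite ?invr_eq0 ?invrK. Qed.
Lemma OunitM x y : Ounit x -> Ounit y -> Ounit (x * y).
Proof.
move=> [x0 Ox Oxi] [y0 Oy Oyi]; split; rewrite ?mulf_neq0 ?invfM //; exact: OM.
Qed.
Lemma Ounit1 : Ounit 1.
Proof. by split; rewrite ?oner_neq0 ?invr1 //; apply: O1. Qed.
Lemma OunitX x k : Ounit x -> Ounit (x ^+ k).
Proof.
by move=> ux; elim: k => [|k IH]; [apply: Ounit1 | rewrite exprS; apply: OunitM].
Qed.
Lemma Ounit_qpoch x p k :
  (forall j, (j < k)%N -> Ounit (1 - x * p ^+ j)) -> Ounit (qpoch x p k).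
Proof.
elim: k => [|k IH] h; first by rewrite qpoch0; apply: Ounit1.
by rewrite qpochS; apply: OunitM; [apply: IH => j /ltnW|]; apply: h.
Qed.

Definition Omul (e x : F) := exists2 y, O y & x = e * y.

Lemma OmulD e x y : Omul e x -> Omul e y -> Omul e (x + y).
Proof. by move=> [u Ou ->] [v Ov ->]; exists (u + v); [apply: OD | rewrite mulrDr]. Qed.
Lemma OmulN e x : Omul e x -> Omul e (- x).
Proof. by move=> [u Ou ->]; exists (- u); [apply: ON | rewrite mulrN]. Qed.
Lemma OmulMl e x y : O x -> Omul e y -> Omul e (x * y).
Proof. by move=> Ox [u Ou ->]; exists (x * u); [apply: OM | rewrite mulrCA]. Qed.
Lemma OmulM e f x y : Omul e x -> Omul f y -> Omul (e * f) (x * y).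
Proof. by move=> [u Ou ->] [v Ov ->]; exists (u * v); [apply: OM | rewrite mulrACA]. Qed.
Lemma Omul_sum e I (s : seq I) (P : pred I) (f : I -> F) :
  (forall i, P i -> Omul e (f i)) -> Omul e (\sum_(i <- s | P i) f i).
Proof.
move=> h; elim/big_ind: _ => //; last exact: OmulD.
by exists 0; [apply: O0 | rewrite mulr0].
Qed.

(* The values of a function of two variables at the corners of a rectangle both
   of whose sides are divisible by pi: its mixed difference is divisible by
   pi ^ 2. *)
Definition quad (f : bool -> bool -> F) :=
  exists g : F * F * F,
    [/\ O (f false false), O g.1.1, O g.1.2 & O g.2] /\
    [/\ f false true = f false false + pi * g.1.1,
        f true false = f false false + pi * g.1.2 &
        f true true = f false false + pi * g.1.1 + pi * g.1.2 + pi ^+ 2 * g.2].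

Lemma quad_ext (f g : bool -> bool -> F) : (forall s t, g s t = f s t) -> quad f -> quad g.
Proof. by move=> e [w h]; exists w; rewrite !e. Qed.

Lemma quad_const x : O x -> quad (fun _ _ => x).
Proof.
by move=> Ox; exists (0, 0, 0); split; split => //=; try exact: O0; rewrite !mulr0 !addr0.
Qed.

Lemma quad_left x x' : O x -> Omul pi (x' - x) -> quad (fun s _ => if s then x' else x).
Proof.
move=> Ox [u Ou e]; exists (0, u, 0); split; split => //=; try exact: O0.
- by rewrite mulr0 addr0.
- by rewrite -e addrC subrK.
- by rewrite !mulr0 !addr0 -e addrC subrK.
Qed.

Lemma quad_right x x' : O x -> Omul pi (x' - x) -> quad (fun _ t => if t then x' else x).
Proof.
move=> Ox [u Ou e]; exists (u, 0, 0); split; split => //=; try exact: O0.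
- by rewrite -e addrC subrK.
- by rewrite mulr0 addr0.
- by rewrite !mulr0 !addr0 -e addrC subrK.
Qed.

Lemma quadD f g : quad f -> quad g -> quad (fun s t => f s t + g s t).
Proof.
move=> [[[u v] w] [[Of Ou Ov Ow] [/= e1 e2 e3]]].
move=> [[[u' v'] w'] [[Og Ou' Ov' Ow'] [/= e1' e2' e3']]].
exists (u + u', v + v', w + w'); split; split => /=; try exact: OD.
all: by rewrite ?e1 ?e2 ?e3 ?e1' ?e2' ?e3'; ring.
Qed.

Lemma quadN f : quad f -> quad (fun s t => - f s t).
Proof.
move=> [[[u v] w] [[Of Ou Ov Ow] [/= e1 e2 e3]]].
exists (- u, - v, - w); split; split => /=; try exact: ON.
all: by rewrite ?e1 ?e2 ?e3; ring.
Qed.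

Lemma quadM f g : quad f -> quad g -> quad (fun s t => f s t * g s t).
Proof.
move=> [[[u v] w] [[Of Ou Ov Ow] [/= e1 e2 e3]]].
move=> [[[u' v'] w'] [[Og Ou' Ov' Ow'] [/= e1' e2' e3']]].
pose x := f false false; pose y := g false false.
exists (x * u' + u * y + pi * (u * u'), x * v' + v * y + pi * (v * v'),
  x * w' + w * y + u * v' + v * u' + pi * ((u + v) * w') + pi * (w * (u' + v'))
  + pi * pi * (w * w')).
split; split => /=; try by do !(apply: OD || apply: OM).
all: by rewrite /x /y ?e1 ?e2 ?e3 ?e1' ?e2' ?e3'; ring.
Qed.

Lemma quadV f : quad f -> (forall s t, Ounit (f s t)) -> quad (fun s t => (f s t)^-1).
Proof.
move=> [[[u v] w] [[Of Ou Ov Ow] [/= e1 e2 e3]]] uf.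
have [x0 Ox Oxi] := uf false false; have [y0 Oy Oyi] := uf false true.
have [z0 Oz Ozi] := uf true false; have [t0 Ot Oti] := uf true true.
pose x := f false false; pose y := f false true.
pose z := f true false; pose t := f true true.
(* The mixed difference of the inverses is pi v (y t - x z) / (x y z t) - pi^2 w / (y t), and y t -
   x z = pi (u t + x (u + pi w)). *)
exists (- (u * (x^-1 * y^-1)), - (v * (x^-1 * z^-1)),
  (v * (u * t + x * (u + pi * w))) * (x^-1 * y^-1 * (z^-1 * t^-1)) - w * (y^-1 * t^-1)).
split; split => //=; try by do !(apply: OD || apply: OB || apply: OM || apply: ON).
all: rewrite /x /y /z /t; move: x0 y0 z0 t0; rewrite ?e1 ?e2 ?e3 => x0 y0 z0 t0.
- by field; rewrite x0 y0.
- by field; rewrite x0 z0.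
- by field; rewrite x0 y0 z0 t0.
Qed.

Lemma quad_prod I (r : seq I) (f : I -> bool -> bool -> F) :
  (forall i, quad (f i)) -> quad (fun s t => \prod_(i <- r) f i s t).
Proof.
move=> qf; elim: r => [|i r IH].
  by apply: quad_ext (quad_const O1) => s t; rewrite big_nil.
by apply: quad_ext (quadM (qf i) IH) => s t; rewrite big_cons.
Qed.

Lemma quad_sum I (r : seq I) (f : I -> bool -> bool -> F) :
  (forall i, quad (f i)) -> quad (fun s t => \sum_(i <- r) f i s t).
Proof.
move=> qf; elim: r => [|i r IH].
  by apply: quad_ext (quad_const O0) => s t; rewrite big_nil.
by apply: quad_ext (quadD (qf i) IH) => s t; rewrite big_cons.
Qed.

Lemma quadX f k : quad f -> quad (fun s t => f s t ^+ k).
Proof.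
move=> qf; elim: k => [|k IH]; first exact: quad_const O1.
by apply: quad_ext (quadM qf IH) => x y; rewrite exprS.
Qed.

Lemma quad_pi f : quad f -> f true false = 0 -> Omul pi (f false false).
Proof.
move=> [[[u v] w] [[Of Ou Ov Ow] [/= e1 e2 e3]]] f10; exists (- v); first exact: ON.
by apply/eqP; rewrite mulrN -addr_eq0 -e2 f10.
Qed.

(** The corner values satisfy f00 = f01 + f10 - f11 modulo pi^2. *)
Lemma quad_pi2 f : quad f -> f true false = 0 -> f true true = 0 ->
  Omul (pi ^+ 2) (f false true) -> Omul (pi ^+ 2) (f false false).
Proof.
move=> [[[u v] w] [[Of Ou Ov Ow] [/= e1 e2 e3]]] f10 f11 [z Oz e4].
exists (z + w); first exact: OD.
have e5 : pi * u + pi ^+ 2 * w = 0.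
  by transitivity (f true true - f true false); [rewrite e3 e2; ring | rewrite f10 f11 subrr].
by rewrite mulrDr -e4 e1 -addrA e5 addr0.
Qed.

End Congruences.

(** * Congruences for the summand *)

Section SummandCongruences.

Variables (F : fieldType) (O : F -> Prop) (pi : F).
Hypothesis OR : subring_prop O.
Hypothesis Opi : O pi.

Lemma Ounit_O x : Ounit O x -> O x. Proof. by case. Qed.
Lemma Ounit_OV x : Ounit O x -> O x^-1. Proof. by case. Qed.

Variables (a b p : F).
Hypotheses (ua : Ounit O a) (ub : Ounit O b) (up : Ounit O p).

Lemma quad_vwp_ratio A e y k :
  quad O pi A -> quad O pi e -> quad O pi y ->
  (forall s t j, (j < k)%N -> Ounit O (1 - y s t * e s t * p ^+ j.+1)) ->
  quad O pi (fun s t => vwp_ratio p (A s t) (e s t) (y s t) k).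
Proof.
move=> qA qe qy uy; apply: (quad_prod OR Opi) => j.
have qp n : quad O pi (fun _ _ => p ^+ n).
  by apply: (quad_const _ OR); apply: (OX OR); apply: Ounit_O.
apply: (quadM OR Opi).
  apply: (quadD OR) => //; apply: (quadN OR).
  by apply: (quadM OR Opi) => //; apply: (quadM OR Opi).
apply: (quadV OR Opi) => [|s t]; last exact: uy.
apply: (quadD OR); first exact: (quad_const _ OR (O1 OR)).
apply: (quadN OR).
by apply: (quadM OR Opi) => //; apply: (quadM OR Opi).
Qed.

(** The summand arises from its parameters by ring operations and inverses of units, under which
    [quad] is stable. *)
Lemma quad_vwp_term A e c k :
  quad O pi A -> quad O pi e -> quad O pi c -> (forall s t, Ounit O (A s t)) ->
  (forall s t j y, (j < k)%N -> y \in [:: a; a^-1; b; b^-1; 1; c s t] ->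
     Ounit O (1 - y * e s t * p ^+ j.+1)) ->
  quad O pi (fun s t => vwp_term a b p (A s t) (e s t) (c s t) k).
Proof.
move=> qA qe qc uA uy.
have qcst x : O x -> quad O pi (fun _ _ => x) by apply: (quad_const _ OR).
have qM := quadM OR Opi.
have Op n : O (p ^+ n) by apply: (OX OR); apply: Ounit_O.
have qR y : y \in [:: a; a^-1; b; b^-1; 1] -> O y ->
    quad O pi (fun s t => vwp_ratio p (A s t) (e s t) y k).
  move=> hy Oy; apply: quad_vwp_ratio => // [|s t j lt_jk]; first exact: qcst.
  by apply: uy => //; move: hy; rewrite !inE => /or4P[->|->|->|/orP[]->]; rewrite ?orbT.
have qRc : quad O pi (fun s t => vwp_ratio p (A s t) (e s t) (c s t) k).
  apply: quad_vwp_ratio => // s t j lt_jk.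
  by apply: uy => //; rewrite !inE eqxx !orbT.
rewrite /vwp_term; apply: (qM); last first.
  apply: (qM _ _ _ qRc); apply: (qM); last by apply: qR (O1 OR); rewrite !inE eqxx ?orbT.
  apply: (qM); last by apply: qR (Ounit_OV ub); rewrite !inE eqxx ?orbT.
  apply: (qM); last by apply: qR (Ounit_O ub); rewrite !inE eqxx ?orbT.
  apply: (qM); last by apply: qR (Ounit_OV ua); rewrite !inE eqxx ?orbT.
  by apply: qR (Ounit_O ua); rewrite !inE eqxx ?orbT.
apply: (qM).
  apply: (quadD OR); first exact: (qcst _ (O1 OR)).
  apply: (quadN OR); apply: (qM); last exact: qcst.
  by apply: (qM) => //; apply: (quadX OR Opi).
apply: (quadX OR Opi); apply: (qM); first exact: qcst.
apply: (quadV OR Opi) => [|s t]; first exact: (quadX OR Opi).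
exact: (OunitX OR).
Qed.

(** * Congruence modulo [pi] for sums over blocks of length [m] *)

Section Blocks.

Variables (q : F) (m r : nat).
Hypotheses (uq : Ounit O q) (lt_rm : (r < m)%N).
Hypothesis qpr : Omul O pi (q * p ^+ r - 1).
Hypothesis pm : Omul O pi (p ^+ m - 1).
Hypothesis uprim : forall s, ~~ (m %| s)%N -> Ounit O (1 - p ^+ s).
Hypothesis uab : forall y s, y \in [:: a; a^-1; b; b^-1] -> Ounit O (1 - y * p ^+ s).
Hypothesis Oblock : forall i, O ((1 - q * p ^+ (i * m + r)) / (1 - p ^+ (i.+1 * m))).
Hypothesis p1 : forall s, 1 - p ^+ s.+1 != 0.
Hypothesis nz2 : 2%:R != 0 :> F.

Lemma qA_Omul : Omul O pi (p ^- r - q).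
Proof.
have [p0 Op Opi'] := OunitX OR r up; have [x Ox e] := qpr.
exists (- (p ^- r * x)); first by apply: (ON OR); apply: (OM OR).
have -> : q = p ^- r * (q * p ^+ r - 1) + p ^- r.
  by move: p0; move: (p ^+ r) => u u0; field.
by rewrite e; ring.
Qed.

Lemma neq0_abc c : (forall s, 1 - c * p ^+ s.+1 != 0) ->
  forall y s, y \in [:: a; a^-1; b; b^-1; 1; c] -> 1 - y * p ^+ s.+1 != 0.
Proof.
move=> hc y s; rewrite (mem_cat _ [:: a; a^-1; b; b^-1] [:: 1; c]).
case/orP=> [/(uab s.+1)[]//|]; rewrite !inE => /orP[]/eqP-> //.
by rewrite mul1r.
Qed.

(** Each block has a single denominator factor that may fail to be a unit, 1 - p^((i+1)m). It is
    paired with the numerator factor 1 - q p^(im+r), and [Oblock] controls the quotient. *)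
Lemma O_vwp_ratio1 l : O (vwp_ratio p q 1 1 (l * m)).
Proof.
have Op n : O (p ^+ n) by apply: (OX OR); apply: Ounit_O.
elim: l => [|l IH]; first by rewrite /vwp_ratio big_ord0; apply: (O1 OR).
rewrite mulSn addnC vwp_ratioD; apply: (OM OR) => //; rewrite /vwp_ratio big_split /=.
rewrite prodfV (bigD1 (Ordinal lt_rm)) //= mul1r.
have [m' def_m] : exists m', m = m'.+1 by exists m.-1; rewrite prednK // (leq_ltn_trans _ lt_rm).
have -> : \prod_(i < m) (1 - 1 * p ^+ (l * m) * p ^+ i.+1)
   = (1 - p ^+ (l.+1 * m)) * \prod_(i < m') (1 - p ^+ (l * m + i.+1)).
  transitivity (\prod_(i < m'.+1) (1 - 1 * p ^+ (l * m) * p ^+ i.+1)).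
    by rewrite -def_m.
  rewrite big_ord_recr /= mulrC; congr (_ * _).
    by rewrite mul1r -exprD -def_m mulSn addnC.
  by apply: eq_bigr => i _; rewrite mul1r -exprD.
rewrite invfM mulrACA; apply: (OM OR).
  by rewrite -mulrA -exprD.
apply: (OM OR).
  apply: (Oprod OR) => i _; apply: (OB OR); first exact: (O1 OR).
  by do !apply: (OM OR) => //; apply: Ounit_O.
rewrite -prodfV; apply: (Oprod OR) => i _; apply: Ounit_OV; apply: uprim.
by rewrite dvdn_addr ?dvdn_mull // def_m gtnNdvd // ltnS.
Qed.

Lemma vwp_block_sum l : Omul O pi (\sum_(k < l * m) vwp_term a b p q 1 1 k).
Proof.
have Op n : O (p ^+ n) by apply: (OX OR); apply: Ounit_O.
elim: l => [|l IH]; first by rewrite big_ord0; exists 0; rewrite ?mulr0 //; apply: (O0 OR).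
rewrite mulSn addnC big_split_ord /=; apply: (OmulD OR) => //.
have p0 : p != 0 by case: up.
(* The common factor of the block that starts at [l * m]; the remaining sum starts at 0 with the
   shift e = p^(lm). *)
pose C := (p ^+ 2 / q ^+ 3) ^+ (l * m)
  * (vwp_ratio p q 1 a (l * m) * vwp_ratio p q 1 a^-1 (l * m) * vwp_ratio p q 1 b (l * m)
     * vwp_ratio p q 1 b^-1 (l * m) * vwp_ratio p q 1 1 (l * m) * vwp_ratio p q 1 1 (l * m)).
have -> : \sum_(i < m) vwp_term a b p q 1 1 (l * m + i)
   = C * \sum_(i < m) vwp_term a b p q (p ^+ (l * m)) 1 i.
  rewrite mulr_sumr; apply: eq_bigr => i _; rewrite /vwp_term /C !vwp_ratioD.
  rewrite !mul1r expr1n mulr1 mulnDr exprD (exprD (_ / _)) mulnC exprM.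
  by ring.
apply: (OmulMl OR).
  have Oy y : y \in [:: a; a^-1; b; b^-1] -> O y -> O (vwp_ratio p q 1 y (l * m)).
    move=> hy Oy; apply: (Oprod OR) => j _; apply: (OM OR).
      apply: (OB OR) => //; rewrite mulr1; apply: (OM OR) => //.
      exact: Ounit_O.
    by apply: Ounit_OV; rewrite mulr1; apply: uab.
  have [[a0 Oa Oai] [b0 Ob Obi]] := (ua, ub).
  apply: (OM OR).
    by apply: Ounit_O; do !apply: (OunitX OR); apply: (OunitM OR);
      [|apply: OunitV]; apply: (OunitX OR).
  by do !apply: (OM OR); try exact: O_vwp_ratio1; apply: Oy; rewrite // !inE eqxx ?orbT.
(* The variable [s] moves [A] from [q] to p^-r and [e] from p^(lm) to 1, both congruent modulo [pi];
   at the far end the sum vanishes by antisymmetry. *)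
pose f (s t : bool) := \sum_(i < m)
  vwp_term a b p (if s then p ^- r else q) (if s then 1 else p ^+ (l * m)) 1 i.
have pml : Omul O pi (1 - p ^+ (l * m)).
  elim: (l) => [|l' [u Ou e]]; first by exists 0; rewrite ?mulr0 ?subrr //; apply: (O0 OR).
  have [v Ov e'] := pm.
  exists (u - p ^+ (l' * m) * v); first by apply: (OB OR) => //; apply: (OM OR).
  by rewrite mulrBr -e mulrCA -e' mulSn addnC exprD; ring.
have qf : quad O pi f.
  apply: (quad_sum OR) => i; apply: quad_vwp_term.
  - by apply: (quad_left OR); [apply: Ounit_O | apply: qA_Omul].
  - by apply: (quad_left OR).
  - by apply: (quad_const _ OR (O1 OR)).
  - by case=> _ //; apply: OunitV; apply: (OunitX OR).
  move=> s t j y lt_ji; rewrite (mem_cat _ [:: a; a^-1; b; b^-1] [:: 1; 1]) => /orP[hy|].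
    by rewrite -mulrA; case: s; rewrite ?mul1r -?exprD; apply: uab.
  rewrite !inE orbb => /eqP ->; rewrite mul1r.
  have h : ~~ (m %| j.+1)%N by rewrite gtnNdvd // (leq_ltn_trans lt_ji).
  case: s; rewrite ?mul1r -?exprD; apply: uprim => //.
  by rewrite dvdn_addr // dvdn_mull.
apply: (quad_pi OR qf).
apply: (@vwp_antisym_sum _ a b p _ r) => //; last apply: neq0_abc => s.
  by rewrite mulVf // expf_neq0.
by rewrite mul1r.
Qed.

Lemma vwp_ratio_qpoch (y : F) k : y != 0 ->
  vwp_ratio p q 1 y k = y ^+ k * qpoch (q / y) p k / qpoch (y * p) p k.
Proof.
move=> y0; elim: k => [|k IH].
  by rewrite /vwp_ratio big_ord0 !qpoch0 expr0 mul1r divr1.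
rewrite vwp_ratioS IH !qpochS !mulr1 !exprS invfM mulrA.
rewrite -!(mulrA y p) -!(exprS p).
have -> : y - q * p ^+ k = y * (1 - q / y * p ^+ k) by field.
move: (qpoch (y * p) p k)^-1 (1 - y * p ^+ k.+1)^-1 => u v.
by ring.
Qed.

(** For c = q p^r the parameter [q / c] is p^-r, which terminates the series. The pair [q b],
    [q / b] is singled out for the expansion in Watson's transformation. *)
Lemma vwp_term_watson k :
  vwp_term a b p q 1 (q * p ^+ r) k
  = phi65_term p q (q * a) (q / a) (p ^- r) k
    * (qpoch (q * b) p k * qpoch (q / b) p k
         / (qpoch (q * p / (q * b)) p k * qpoch (q * p / (q / b)) p k)
       * (q * p / (q * b * (q / b))) ^+ k).
Proof.
have [a0 _ _] := ua; have [b0 _ _] := ub; have [p0 _ _] := up; have [q0 _ _] := uq.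
have r0 : p ^+ r != 0 by rewrite expf_neq0.
have e1 (y : F) : y != 0 -> q * p / (q * y) = y^-1 * p by move=> y0; field; rewrite y0 q0.
rewrite /vwp_term /phi65_term !vwp_ratio_qpoch ?mulf_neq0 ?invr_eq0 ?oner_neq0 //.
rewrite !e1 ?invr_eq0 // !invrK mul1r divr1 expr1n !mulr1.
have -> : q / (q * p ^+ r) = p ^- r by field; rewrite r0 q0.
have -> : q * p ^+ r * p = q * p * p ^+ r by rewrite mulrAC.
have e3 : (p ^+ 2 / q ^+ 3) ^+ k * (q * p ^+ r) ^+ k
   = (q * p / (q * a * (q / a) / p ^+ r)) ^+ k * (q * p / (q * b * (q / b))) ^+ k.
  rewrite -!exprMn; congr (_ ^+ _); move: (p ^+ r) r0 => R R0.
  by field; rewrite ?a0 ?b0 ?q0 ?R0.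
have e4 (y : F) : y != 0 -> y ^+ k * y^-1 ^+ k = 1 by move=> y0; rewrite -exprMn divff ?expr1n.
have := e4 _ a0; have := e4 _ b0; move: e3; rewrite !expr1n.
move: ((p ^+ 2 / q ^+ 3) ^+ k) ((q * p ^+ r) ^+ k) => U V.
move: ((q * p / (q * a * (q / a) / p ^+ r)) ^+ k) ((q * p / (q * b * (q / b))) ^+ k) => W Z.
move: (a ^+ k) (a^-1 ^+ k) (b ^+ k) (b^-1 ^+ k) => A1 A2 B1 B2.
move=> e5 e6 e7; rewrite !invfM.
ring: e5 e6 e7.
Qed.

(** * Congruence modulo the square of [pi] *)

Section Square.

Hypothesis uqpr : forall s, ~~ (m %| s)%N -> Ounit O (1 - q * p ^+ r * p ^+ s).
Hypothesis q1 : forall s, 1 - q * p ^+ s.+1 != 0.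
Variable s0 : nat.
Hypothesis qs0 : Omul O pi (1 - p / q * p ^+ s0).
Hypothesis s0r : (2 * s0 < r)%N.

Lemma Omul_qpoch x k s : O x -> (s < k)%N -> Omul O pi (1 - x * p ^+ s) ->
  Omul O pi (qpoch x p k).
Proof.
move=> Ox lt_sk h; rewrite /qpoch (bigD1 (Ordinal lt_sk)) //= mulrC.
apply: (OmulMl OR) => //; apply: (Oprod OR) => i _.
apply: (OB OR); first exact: (O1 OR).
by apply: (OM OR) => //; apply: (OX OR); apply: Ounit_O.
Qed.

Lemma O_qpoch x k : O x -> O (qpoch x p k).
Proof.
move=> Ox; apply: (Oprod OR) => i _; apply: (OB OR); first exact: (O1 OR).
by apply: (OM OR) => //; apply: (OX OR); apply: Ounit_O.
Qed.

Lemma Omul_watson : Omul O (pi ^+ 2) (\sum_(k < m) vwp_term a b p q 1 (q * p ^+ r) k).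
Proof.
have [a0 Oa _] := ua; have [b0 Ob _] := ub; have [p0 Op _] := up; have [q0 Oq _] := uq.
have r0 : p ^+ r != 0 by rewrite expf_neq0.
rewrite -(big_mkord predT (vwp_term a b p q 1 (q * p ^+ r))) (@big_cat_nat _ _ _ r.+1) //=.
rewrite [X in _ + X]big_nat [X in _ + X]big1 ?addr0; last first.
  move=> k /andP[lt_rk _]; rewrite /vwp_term.
  (* Beyond [r] the ratio of c = q p^r contains the factor c - q p^r. *)
  have -> : vwp_ratio p q 1 (q * p ^+ r) k = 0; last by rewrite !mulr0.
  by rewrite /vwp_ratio (bigD1 (Ordinal lt_rk)) //= mulr1 subrr !mul0r.
rewrite big_mkord; under eq_bigr do rewrite vwp_term_watson.
have e1 (y : F) : y != 0 -> q * p / (q * y) = y^-1 * p by move=> y0; field; rewrite y0 q0.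
have e2 (y : F) : y != 0 -> q * p / (q * y * (q / y)) = p / q by move=> y0; field; rewrite y0 q0.
have uab' y s : y \in [:: a; a^-1; b; b^-1] -> Ounit O (1 - y * p * p ^+ s).
  by move=> hy; rewrite -mulrA -exprS; apply: uab.
rewrite (@watson_sum F p p0 p1); last first.
- by move=> s; rewrite e1 ?invr_eq0 // invrK; case: (uab' b s) => //; rewrite !inE eqxx ?orbT.
- by move=> s; rewrite e1 //; case: (uab' b^-1 s) => //; rewrite !inE eqxx ?orbT.
- by move=> s; rewrite e1 ?invr_eq0 // invrK; case: (uab' a s) => //; rewrite !inE eqxx ?orbT.
- by move=> s; rewrite e1 //; case: (uab' a^-1 s) => //; rewrite !inE eqxx ?orbT.
- by move=> s; rewrite -mulrA -exprS; apply: q1.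
- by rewrite mulf_neq0 ?invr_eq0.
- by rewrite mulf_neq0 ?invr_eq0.
- by rewrite mulf_neq0 ?invr_eq0.
- by rewrite mulf_neq0 ?invr_eq0.
have Opq : O (p / q) by apply: (OM OR) => //; apply: Ounit_OV.
apply: (Omul_sum OR) => -[j /= le_jr] _; rewrite ltnS in le_jr.
rewrite !e2 // !e1 ?invr_eq0 // !invrK /phi65_coef !e1 ?invr_eq0 // !invrK.
set W := q * p / (q * a * (q / a) * p ^- r).
have OW : O W.
  apply: Ounit_O; apply: (OunitM OR); first exact: (OunitM OR).
  apply: OunitV; apply: (OunitM OR); last by apply: OunitV; apply: (OunitX OR).
  by apply: (OunitM OR); apply: (OunitM OR) => //; apply: OunitV.
have Ok : O (pochV_coef p j).
  apply: (Oprod OR) => i _; apply: (ON OR); apply: Ounit_OV; exact: (OunitX OR).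
have upoch y k : y \in [:: a; a^-1; b; b^-1] -> O (qpoch (y * p) p k)^-1.
  by move=> hy; apply: Ounit_OV; apply: (Ounit_qpoch OR) => i _; apply: uab'.
have upoch' y k l : y \in [:: a; a^-1; b; b^-1] -> O (qpoch (y * p * p ^+ l) p k)^-1.
  move=> hy; apply: Ounit_OV; apply: (Ounit_qpoch OR) => i _.
  by rewrite -[y * p * _ * _]mulrA -exprD; apply: uab'.
have ndvd i : (i < j)%N -> ~~ (m %| i.+1)%N.
  by move=> lt_ij; rewrite gtnNdvd // (leq_ltn_trans _ lt_rm) // (leq_trans lt_ij).
have up_j : O (qpoch p p j)^-1.
  apply: Ounit_OV; apply: (Ounit_qpoch OR) => i lt_ij; rewrite -exprS.
  exact/uprim/ndvd.
(* The factors are 1 - q p^(r+i+1) with 0 < i + 1 < m, hence units by [uqpr]. *)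
have uq_j : O (qpoch (q * p * p ^+ r) p j)^-1.
  apply: Ounit_OV; apply: (Ounit_qpoch OR) => i lt_ij.
  rewrite -[q * p * _]mulrA -exprS exprSr mulrA -[_ * p * _]mulrA -exprS.
  exact/uqpr/ndvd.
(* The two products join to (q;p)_(r+j+1), whose factor of index [r] is 1 - q p^r. *)
have Hq : Omul O pi (qpoch q p (j + j) * qpoch (q * p ^+ (j + j)) p (r - j).+1).
  rewrite -qpochD; apply: (@Omul_qpoch _ _ r) => //; first lia.
  by rewrite -opprB; apply: (OmulN OR).
(* As 2 * s0 < r, one of j and r - j exceeds s0. *)
have Hpq : Omul O pi (qpoch (p / q) p j * qpoch (p / q) p (r - j)).
  have [lt_sj|le_js] := ltnP s0 j.
    by rewrite mulrC; apply: (OmulMl OR); [apply: O_qpoch | apply: (Omul_qpoch _ lt_sj)].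
  apply: (OmulMl OR); first exact: O_qpoch.
  by apply: (@Omul_qpoch _ _ s0) => //; lia.
have := OmulM OR Hq Hpq; rewrite -expr2.
move: (qpoch q p (j + j)) (qpoch (q * p ^+ (j + j)) p _) => A1 A2.
move: (qpoch (p / q) p j) (qpoch (p / q) p (r - j)) => A3 A4 H.
rewrite !invfM.
(* Isolates the four factors that carry pi^2; all the others lie in [O]. *)
have group P1 P2 P3 Pj C Wj N1 N2 N3 D1 D2 D3 E1 E2 :
  A3 * (P1 * P2 * P3) * Pj * (C * Wj * (N1 * N2 * N3 * A1) * (D1 * D2 * D3)
    * (A2 * A4 * (E1 * E2)))
  = P1 * P2 * P3 * Pj * (C * Wj) * (N1 * N2 * N3) * (D1 * D2 * D3) * (E1 * E2)
    * (A1 * A2 * (A3 * A4)) by ring.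
rewrite group; apply: (OmulMl OR) => //.
have [in1 in2 in3 in4] : [/\ a \in [:: a; a^-1; b; b^-1], a^-1 \in [:: a; a^-1; b; b^-1],
    b \in [:: a; a^-1; b; b^-1] & b^-1 \in [:: a; a^-1; b; b^-1]].
  by rewrite !inE !eqxx !orbT.
have OpX k : O (p ^+ k) by apply: (OX OR).
have O1' : O (qpoch (q * a) p j) by apply: O_qpoch; apply: (OM OR).
have O2' : O (qpoch (q / a) p j) by apply: O_qpoch; apply: (OM OR) => //; apply: Ounit_OV.
have O3' : O (qpoch (p ^- r) p j) by apply: O_qpoch; apply: Ounit_OV; apply: (OunitX OR).
have OWj : O (W ^+ j) by apply: (OX OR).
by do !apply: (OM OR) => //; (exact: upoch || exact: upoch').
Qed.

Lemma vwp_square_sum : Omul O (pi ^+ 2) (\sum_(k < m) vwp_term a b p q 1 1 k).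
Proof.
have [p0 Op _] := up; have [q0 Oq _] := uq.
have OpX k : O (p ^+ k) by apply: (OX OR).
have r0 : p ^+ r != 0 by rewrite expf_neq0.
(* The variable [s] moves [A] from [q] to p^-r, and [t] moves [c] from 1 to q p^r. Both corners with
   [s] true vanish by antisymmetry, and Watson's transformation handles the corner with only [t]
   true. *)
pose f (s t : bool) := \sum_(i < m)
  vwp_term a b p (if s then p ^- r else q) 1 (if t then q * p ^+ r else 1) i.
have qf : quad O pi f.
  apply: (quad_sum OR) => i; apply: quad_vwp_term.
  - by apply: (quad_left OR) => //; apply: qA_Omul.
  - by apply: (quad_const _ OR (O1 OR)).
  - by apply: (quad_right OR) => //; apply: (O1 OR).
  - by case=> _ //; apply: OunitV; apply: (OunitX OR).
  move=> s t j y lt_ji; rewrite mulr1.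
  rewrite (mem_cat _ [:: a; a^-1; b; b^-1] [:: 1; _]) => /orP[hy|]; first exact: uab.
  have h : ~~ (m %| j.+1)%N by rewrite gtnNdvd // (leq_ltn_trans lt_ji).
  rewrite !inE; case: t => [|]; rewrite ?orbb => hy.
    by case/orP: hy => /eqP->; rewrite ?mul1r; [apply: uprim | apply: uqpr].
  by rewrite (eqP hy) mul1r; apply: uprim.
have Ap : p ^- r * p ^+ r = 1 by rewrite mulVf.
apply: (quad_pi2 OR qf); last exact: Omul_watson.
- apply: (@vwp_antisym_sum _ a b p _ r) => //.
  by apply: neq0_abc => s; rewrite mul1r.
- apply: (@vwp_antisym_sum _ a b p _ r) => //.
  by apply: neq0_abc => s; rewrite -mulrA -exprD addnS.
Qed.

End Square.
End Blocks.
End SummandCongruences.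

(** * Cyclotomic polynomials over a field of characteristic zero *)

Section Cyclotomic.

Variable K : fieldType.
Hypothesis char0 : forall n, n.+1%:R != 0 :> K.
Implicit Types P Q u v D : {poly K}.

Local Notation Phi := (cyclotomic_poly K).

Lemma dvdp_Xn1 m n : (m %| n)%N -> ('X^m - 1 : {poly K}) %| 'X^n - 1.
Proof.
by case/dvdnP=> k ->; rewrite mulnC exprM (subrX1 ('X^m) k) dvdp_mulIl.
Qed.

Lemma prod_cyclotomic_poly n : (0 < n)%N -> \prod_(m <- divisors n) Phi m = 'X^n - 1.
Proof.
move=> n0; have := congr1 (map_poly (intr : int -> K)) (prod_Cyclotomic n0).
by rewrite rmorph_prod /= rmorphB rmorph1 /= map_polyXn.
Qed.

Lemma cyclotomic_poly1 : Phi 1 = 'X - 1.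
Proof. by have := prod_cyclotomic_poly (ltn0Sn 0); rewrite big_seq1. Qed.

Lemma cyclotomic_poly_dvdXn m : (0 < m)%N -> Phi m %| 'X^m - 1.
Proof.
move=> m0; rewrite -prod_cyclotomic_poly // (bigD1_seq m) ?divisors_uniq //=.
  exact: dvdp_mulIl.
by rewrite -dvdn_divisors.
Qed.

(** Both are factors, at different indices, of X^n - 1, which is separable in characteristic
    zero. *)
Lemma coprimep_cyclotomic n i j : (0 < n)%N -> (i %| n)%N -> (j %| n)%N -> i != j ->
  coprimep (Phi i) (Phi j).
Proof.
move=> n0 i_n j_n ne_ij.
have := @separable_Xn_sub_1 K n; rewrite -{1}(prednK n0) char0 => /(_ isT).
rewrite -prod_cyclotomic_poly // (bigD1_seq i) ?divisors_uniq -?dvdn_divisors //=.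
rewrite separable_mul => /and3P[_ _]; apply: coprimep_dvdl.
rewrite -big_filter (bigD1_seq j) /= ?filter_uniq ?divisors_uniq //.
  exact: dvdp_mulIl.
by rewrite mem_filter eq_sym ne_ij -dvdn_divisors.
Qed.

(** A common divisor divides X^m - 1 and X^j - 1, hence X^g - 1 with g = gcd(m, j). As [m] does not
    divide [j], the cyclotomic factors of the latter have indices other than [m]. *)
Lemma coprimep_cyclotomic_Xn m j : (0 < m)%N -> ~~ (m %| j)%N ->
  coprimep (Phi m) (1 - 'X^j).
Proof.
move=> m0 ndvd; apply/coprimepP => D dvD dvj.
have [u v e _] := egcdnP j m0.
have g0 : (0 < gcdn m j)%N by rewrite gcdn_gt0 m0.
have dvm : D %| 'X^m - 1 by apply: dvdp_trans dvD (cyclotomic_poly_dvdXn m0).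
have dvj' : D %| 'X^j - 1 by rewrite -opprB dvdpNr.
have dvg : D %| 'X^(gcdn m j) - 1.
  have h1 : D %| 'X^(u * m) - 1 by apply: dvdp_trans dvm _; apply/dvdp_Xn1/dvdn_mull.
  have h2 : D %| 'X^(v * j) - 1 by apply: dvdp_trans dvj' _; apply/dvdp_Xn1/dvdn_mull.
  have -> : 'X^(gcdn m j) - 1
     = ('X^(u * m) - 1) - 'X^(gcdn m j) * ('X^(v * j) - 1) :> {poly K}.
    by rewrite e exprD; ring.
  by rewrite dvdp_sub // dvdp_mull.
have co : coprimep (Phi m) ('X^(gcdn m j) - 1).
  rewrite -prod_cyclotomic_poly // big_seq; apply: (big_rec (coprimep (Phi m))) => [|i P].
    exact: coprimep1.
  rewrite -dvdn_divisors // dvdn_gcd => /andP[i_m i_j] coP; rewrite coprimepMr coP andbT.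
  rewrite (@coprimep_cyclotomic m) // eq_sym.
  by apply: contraNneq ndvd => <-.
by move/coprimepP: co; apply.
Qed.

Lemma coprimep_cyclotomic_const m P Q : (0 < m)%N ->
  'X^m - 1 %| P - Q -> coprimep (Phi m) Q -> coprimep (Phi m) P.
Proof.
move=> m0 dvPQ /coprimepP co; apply/coprimepP => D dvD dvP.
apply: co => //; rewrite -[Q](subKr P) dvdp_sub //.
apply: dvdp_trans dvPQ; apply: dvdp_trans dvD _; exact: cyclotomic_poly_dvdXn.
Qed.

(** Modulo a common divisor X^m = 1 and y X^j = 1, so the divisor divides the nonzero constant y^m -
    1. *)
Lemma coprimep_cyclotomic_scale m j (y : K) : (0 < m)%N -> y ^+ m != 1 ->
  coprimep (Phi m) (1 - y%:P * 'X^j).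
Proof.
move=> m0 ym; apply/coprimepP => D dvD dvP.
have dvm : D %| 'X^(m * j) - 1.
  apply: dvdp_trans (dvdp_trans dvD (cyclotomic_poly_dvdXn m0)) _.
  exact/dvdp_Xn1/dvdn_mulr.
have : D %| (y ^+ m)%:P - 1.
  have -> : (y ^+ m)%:P - 1 = ((y%:P * 'X^j) ^+ m - 1) - (y ^+ m)%:P * ('X^(m * j) - 1).
    by rewrite exprMn -exprM mulnC polyC_exp; ring.
  rewrite dvdp_sub ?dvdp_mull // subrX1 dvdp_mulr //.
  by rewrite -opprB dvdpNr.
rewrite -polyC1 -polyCB => /dvdp_eqp1; rewrite polyC1; apply.
by rewrite polyC_eqp1 subr_eq0.
Qed.

(** Modulo X^m - 1 the sum is the nonzero constant [k + 1]. *)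
Lemma coprimep_cyclotomic_qint m k : (0 < m)%N ->
  coprimep (Phi m) (\sum_(i < k.+1) 'X^m ^+ i).
Proof.
move=> m0; apply: (@coprimep_cyclotomic_const _ _ (k.+1%:R)%:P) => //.
  rewrite polyC_natr; have -> : k.+1%:R = \sum_(i < k.+1) 1 :> {poly K}.
    by rewrite sumr_const card_ord.
  rewrite -sumrB.
  elim/big_ind: _ => [|u v|i _]; [exact: dvdp0 | exact: dvdp_add |].
  by rewrite (subrX1 'X^m i) dvdp_mulIl.
by apply/coprimepP => D _ /dvdp_eqp1; apply; rewrite polyC_eqp1.
Qed.

Lemma qint_poly_prod n : (0 < n)%N ->
  qint_poly K n = \prod_(m <- divisors n | m != 1%N) Phi m.
Proof.
move=> n0; rewrite /qint_poly -opprB -prod_cyclotomic_poly //.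
rewrite (bigD1_seq 1%N) ?divisors_uniq //=; last by rewrite -dvdn_divisors.
rewrite cyclotomic_poly1 -mulNr opprB mulKp //.
by rewrite -opprB oppr_eq0 polyXsubC_eq0.
Qed.

End Cyclotomic.

Lemma summandE (F : fieldType) (a b q : F) (d k : nat) :
  a != 0 -> b != 0 -> q != 0 -> (3 <= d)%N ->
  qint q (2 * d * k + 1)%N
      * ((qpochs [:: a * q; q / a; b * q; q / b] (q ^+ d) k
            * qpoch q (q ^+ d) k ^+ 2)
         / (qpochs [:: a * q ^+ d; q ^+ d / a; b * q ^+ d; q ^+ d / b]
              (q ^+ d) k
            * qpoch (q ^+ d) (q ^+ d) k ^+ 2))
      * q ^+ ((2 * d - 3) * k)
  = (1 - q)^-1 * vwp_term a b (q ^+ d) q 1 1 k.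
Proof.
move=> a0 b0 q0 d3; rewrite /vwp_term /qpochs !big_cons !big_nil.
rewrite !vwp_ratio_qpoch ?invr_eq0 ?oner_neq0 // !invrK divr1 mul1r !expr1n mulr1.
rewrite /qint -exprnP.
have -> : q ^+ (2 * d * k + 1) = q * q ^+ d ^+ (2 * k).
  by rewrite -exprM -exprS addn1; congr (_ ^+ _); lia.
(* This is the argument p^2 / A^3 at A = q; the truncated subtraction is exact because [d >= 3]. *)
have -> : q ^+ ((2 * d - 3) * k) = (q ^+ d ^+ 2 / q ^+ 3) ^+ k.
  rewrite exprM; congr (_ ^+ k); rewrite -exprM.
  have -> : (d * 2 = (2 * d - 3) + 3)%N by lia.
  by rewrite exprD mulfK // expf_neq0.
have e4 (y : F) : y != 0 -> y ^+ k * y^-1 ^+ k = 1 by move=> y0; rewrite -exprMn divff ?expr1n.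
move: (e4 _ a0) (e4 _ b0); rewrite ![_ * q]mulrC ![_ * q ^+ d]mulrC.
move: (a ^+ k) (a^-1 ^+ k) (b ^+ k) (b^-1 ^+ k) => A1 A2 B1 B2 e5 e6.
move: ((_ / _) ^+ k) => W; rewrite !(invfM, invr1, mulr1).
ring: e5 e6.
Qed.

(** * Localisation of the polynomial ring *)

Section Localisation.

Variable K : fieldType.
Implicit Types (P Q u v : {poly K}) (x y : {fraction {poly K}}).

Definition localised P x :=
  exists u v, [/\ v != 0, coprimep v P & x = tofrac u / tofrac v].

Lemma localised_subring P : subring_prop (localised P).
Proof.
split.
- by exists 1, 1; rewrite oner_neq0 coprime1p tofrac1 divr1.
- move=> _ _ [u [v [v0 co ->]]] [u' [v' [v0' co' ->]]].
  exists (u * v' - u' * v), (v * v'); rewrite mulf_neq0 // coprimepMl co co'; split => //.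
  by rewrite -mulNr addf_div ?tofrac_eq0 // mulNr tofracB !tofracM.
- move=> _ _ [u [v [v0 co ->]]] [u' [v' [v0' co' ->]]].
  exists (u * u'), (v * v'); rewrite mulf_neq0 // coprimepMl co co'; split => //.
  by rewrite mulf_div !tofracM.
Qed.

Lemma localised_tofrac P u : localised P (tofrac u).
Proof. by exists u, 1; rewrite oner_neq0 coprime1p tofrac1 divr1. Qed.

Lemma Ounit_tofrac P v : v != 0 -> coprimep P v -> Ounit (localised P) (tofrac v).
Proof.
move=> v0 co; split; rewrite ?tofrac_eq0 //; first exact: localised_tofrac.
by exists 1, v; rewrite coprimep_sym co tofrac1 mul1r.
Qed.

(** Dividing by the gcd reduces the fraction. The gcd divides [v], hence is coprime to [P], so [P]
    still divides the numerator. *)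
Lemma rat_congr0P x P : 
  (exists u v, [/\ v != 0, coprimep v P, P %| u & x = tofrac u / tofrac v]) ->
  rat_congr x 0 P.
Proof.
move=> [u [v [v0 co dv ->]]]; have g0 : gcdp u v != 0 by rewrite gcdp_eq0 negb_and v0 orbT.
have eu := divpK (dvdp_gcdl u v); have ev := divpK (dvdp_gcdr u v).
have v0' : v %/ gcdp u v != 0 by apply: contraNneq v0 => e; rewrite -ev e mul0r.
exists (u %/ gcdp u v), (v %/ gcdp u v); split => //.
- by apply: coprimep_div_gcd; rewrite v0 orbT.
- have fu : tofrac u = tofrac (u %/ gcdp u v) * tofrac (gcdp u v) by rewrite -tofracM eu.
  have fv : tofrac v = tofrac (v %/ gcdp u v) * tofrac (gcdp u v) by rewrite -tofracM ev.
  by rewrite subr0 fu fv -mulf_div divff ?mulr1 // tofrac_eq0.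
- have coP : coprimep P (gcdp u v).
    by apply: coprimep_dvdl (dvdp_gcdr u v) _; rewrite coprimep_sym.
  by rewrite -(Gauss_dvdpl _ coP) eu.
- by apply: coprimep_dvdr co; apply/dvdpP; exists (gcdp u v); rewrite mulrC ev.
Qed.

Lemma rat_congr0_Omul x P k :
  Omul (localised P) (tofrac P ^+ k) x -> rat_congr x 0 (P ^+ k).
Proof.
case=> _ [u [v [v0 co ->]]] ->; apply: rat_congr0P; exists (P ^+ k * u), v.
by rewrite v0 coprimep_expr // dvdp_mulIl tofracM tofracXn mulrA.
Qed.

Lemma rat_congr0_1 x P : rat_congr x 0 P -> rat_congr x 0 1.
Proof.
move=> [u [v [v0 co e _ _]]]; exists u, v.
by split; rewrite ?dvd1p ?coprimep1.
Qed.

(** Of two reduced forms of [x], cross multiplication gives that u' divides u and v divides v', so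
    the first form serves both moduli. *)
Lemma rat_congr0M x P Q : coprimep P Q ->
  rat_congr x 0 P -> rat_congr x 0 Q -> rat_congr x 0 (P * Q).
Proof.
move=> coPQ [u [v [v0 co e dP coP]]] [u' [v' [v0' co' e' dQ coQ]]].
have euv : u * v' = u' * v.
  have : tofrac u / tofrac v = tofrac u' / tofrac v' by rewrite -e -e'.
  move/eqP; rewrite eqr_div ?tofrac_eq0 // -!tofracM tofrac_eq => /eqP ->.
  by [].
have dvu : u' %| u by rewrite -(Gauss_dvdpl u co') euv dvdp_mulIl.
have dvv : v %| v'.
  by rewrite -(@Gauss_dvdpr _ _ u) 1?coprimep_sym // euv dvdp_mulIr.
exists u, v; split => //.
- by rewrite Gauss_dvdp // dP (dvdp_trans dQ).
- by rewrite coprimepMr coP (coprimep_dvdr dvv).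
Qed.

(** The separate modulus [P] will be 1 or the square of a cyclotomic polynomial. *)
Lemma rat_congr0_prod (I : eqType) (s : seq I) (f : I -> {poly K}) x P :
  uniq s -> {in s, forall i, rat_congr x 0 (f i)} ->
  {in s, forall i, coprimep P (f i)} ->
  {in s &, forall i j, i != j -> coprimep (f i) (f j)} ->
  rat_congr x 0 P -> rat_congr x 0 (P * \prod_(i <- s) f i).
Proof.
move=> + + + + hP; elim: s => [|i s IH] /=; first by rewrite big_nil mulr1.
case/andP=> i_s us hx hP' co; rewrite big_cons mulrCA.
have hi := mem_head i s; have hs j : j \in s -> j \in i :: s by rewrite inE orbC => ->.
apply: rat_congr0M; first 1 last.
- exact: hx.
- by apply: IH => // [j /hs|j /hs|j k /hs hj /hs hk]; [apply: hx|apply: hP'|apply: co].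
rewrite coprimepMr coprimep_sym hP' //= big_seq.
apply: (big_rec (coprimep (f i))) => [|j Q js coQ]; first exact: coprimep1.
rewrite coprimepMr coQ andbT; apply: co => //; first exact: hs.
by apply: contraNneq i_s => ->.
Qed.

End Localisation.

(** * Congruences modulo a cyclotomic polynomial and its square *)

Section MainCongruences.

Variables (K : fieldType) (alpha beta : K).
Hypothesis char0 : forall n, n.+1%:R != 0 :> K.
Hypotheses (alpha0 : alpha != 0) (beta0 : beta != 0).
Hypothesis alphaX : forall m, alpha ^+ m.+1 != 1.
Hypothesis betaX : forall m, beta ^+ m.+1 != 1.

Local Notation F := {fraction {poly K}}.
Local Notation Phi := (cyclotomic_poly K).
Local Notation q := (tofrac 'X : F).
Local Notation a := (tofrac alpha%:P : F).
Local Notation b := (tofrac beta%:P : F).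

Variables (d m : nat).
Hypotheses (d0 : (0 < d)%N) (m1 : (1 < m)%N) (co_md : coprime m d).

Local Notation O := (localised (Phi m)).
Local Notation p := (q ^+ d).

Let m0 : (0 < m)%N. Proof. exact: ltnW. Qed.
Let OR := localised_subring (Phi m).

Lemma Xn_neq1 e : (0 < e)%N -> 1 - 'X^e != 0 :> {poly K}.
Proof.
case: e => // e _; rewrite -opprB oppr_eq0 -size_poly_gt0.
by rewrite -polyC1 size_XnsubC.
Qed.

Lemma qn_neq1 e : (0 < e)%N -> 1 - q ^+ e != 0.
Proof. by move=> e0; rewrite -tofracXn -tofrac1 -tofracB tofrac_eq0 Xn_neq1. Qed.

Lemma Ounit_q : Ounit O q.
Proof.
apply: Ounit_tofrac; first by rewrite polyX_eq0.
apply/coprimepP => D dvP dvX; apply: (@dvdp_eqp1 _ _ 1); last exact: eqpxx.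
have -> : 1 = 'X^m - ('X^m - 1) :> {poly K} by rewrite subKr.
rewrite dvdp_sub ?dvdp_exp //.
exact: dvdp_trans dvP (cyclotomic_poly_dvdXn _ m0).
Qed.

Lemma Ounit_const c : c != 0 -> Ounit O (tofrac c%:P).
Proof.
move=> c0; apply: Ounit_tofrac; first by rewrite polyC_eq0.
by apply/coprimepP => D _ /dvdp_eqp1; apply; rewrite polyC_eqp1.
Qed.

Lemma Ounit_qn e : ~~ (m %| e)%N -> Ounit O (1 - q ^+ e).
Proof.
move=> ndvd; rewrite -tofracXn -tofrac1 -tofracB; apply: Ounit_tofrac.
  by apply: Xn_neq1; case: e ndvd => //; rewrite dvdn0.
exact: coprimep_cyclotomic_Xn.
Qed.

Lemma Omul_qn e : (m %| e)%N -> Omul O (tofrac (Phi m)) (1 - q ^+ e).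
Proof.
move=> dv; rewrite -tofracXn -tofrac1 -tofracB.
have /dvdpP[u ->] : Phi m %| 1 - 'X^e.
  rewrite -opprB dvdpNr; apply: dvdp_trans (cyclotomic_poly_dvdXn _ m0) _.
  exact: dvdp_Xn1.
exists (tofrac u); first exact: localised_tofrac.
by rewrite mulrC tofracM.
Qed.

Lemma Ounit_scale c e : c ^+ m != 1 -> Ounit O (1 - tofrac c%:P * q ^+ e).
Proof.
move=> cm; rewrite -tofracXn -tofracM -tofrac1 -tofracB.
apply: Ounit_tofrac; last exact: coprimep_cyclotomic_scale.
apply: contraNneq cm => h.
have := congr1 (fun P => P.[1]) h; rewrite !hornerE expr1n mulr1 => /eqP.
by rewrite subr_eq0 => /eqP <-; rewrite expr1n.
Qed.

Lemma tofracV c : c != 0 -> (tofrac c%:P : F)^-1 = tofrac (c^-1)%:P.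
Proof.
move=> c0; have c0' : tofrac c%:P != 0 :> F by rewrite tofrac_eq0 polyC_eq0.
by apply: (mulfI c0'); rewrite divff // -tofracM -polyCM divff // polyC1 tofrac1.
Qed.

(** Holds because [alpha] and [beta] are not roots of unity. *)
Lemma Ounit_ab (y : F) s : y \in [:: a; a^-1; b; b^-1] -> Ounit O (1 - y * p ^+ s).
Proof.
have aX c : (forall k, c ^+ k.+1 != 1) -> c ^+ m != 1 by rewrite -(prednK m0).
rewrite !tofracV // -exprM !inE => /or4P[] /eqP->; apply: Ounit_scale;
  rewrite ?exprVn ?invr_eq1; exact: aX.
Qed.

(** After cancelling 1 - q^m, the denominator is a q-integer in q^m, which is coprime to Phi_m. *)
Lemma O_qn_ratio e f : (m %| e)%N -> (m %| f)%N -> (0 < f)%N ->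
  O ((1 - q ^+ e) / (1 - q ^+ f)).
Proof.
move=> /dvdnP[u ->] /dvdnP[v ->]; rewrite muln_gt0 => /andP[].
case: v => // v _ _.
have E w : 1 - q ^+ (w * m) = (1 - q ^+ m) * tofrac (\sum_(i < w) 'X^m ^+ i).
  rewrite -[LHS]opprB mulnC exprM (subrX1 (q ^+ m)) -mulNr opprB; congr (_ * _).
  by rewrite rmorph_sum /=; apply: eq_bigr => i _; rewrite !tofracXn.
rewrite !E -mulf_div divff ?mul1r ?qn_neq1 //.
apply: (OM OR); first exact: localised_tofrac.
apply: Ounit_OV; apply: Ounit_tofrac; last exact: coprimep_cyclotomic_qint.
apply: contraTneq (ltn0Sn v) => h; have := E v.+1; rewrite h tofrac0 mulr0 => /eqP.
by rewrite (negPf (qn_neq1 _)) // muln_gt0.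
Qed.

Lemma fraction_nz2 : 2%:R != 0 :> F.
Proof.
rewrite -(rmorph_nat (@FracField.tofrac {poly K})) tofrac_eq0.
by rewrite -polyC_natr polyC_eq0.
Qed.

Lemma Omul_qpr r e : (m %| e)%N -> (d * r + 1 = e)%N ->
  Omul O (tofrac (Phi m)) (q * p ^+ r - 1).
Proof.
move=> dv er; rewrite -opprB -exprM -exprS -addn1 er.
by apply: (OmulN OR); apply: Omul_qn.
Qed.

Lemma ndvd_mul s : ~~ (m %| s)%N -> ~~ (m %| d * s)%N.
Proof. by rewrite Gauss_dvdr. Qed.

Lemma block_congr r l : (r < m)%N -> (m %| d * r + 1)%N ->
  Omul O (tofrac (Phi m)) (\sum_(k < l * m) vwp_term a b p q 1 1 k).
Proof.
move=> lt_rm dv.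
apply: (@vwp_block_sum F O _ OR _ a b p _ _ _ q m r) => //.
- exact: localised_tofrac.
- exact: Ounit_const.
- exact: Ounit_const.
- by apply: (OunitX OR); apply: Ounit_q.
- exact: Ounit_q.
- exact: (Omul_qpr dv).
- rewrite -opprB -exprM; apply: (OmulN OR); apply: Omul_qn; exact: dvdn_mull.
- by move=> s /ndvd_mul h; rewrite -exprM; apply: Ounit_qn.
- by move=> y s; apply: Ounit_ab.
- move=> i; rewrite -!exprM -exprS -addn1; apply: O_qn_ratio.
  + by rewrite mulnDr -addnA dvdn_addr // mulnA dvdn_mull.
  + by rewrite mulnA dvdn_mull.
  + by rewrite !muln_gt0 d0.
- by move=> s; rewrite -exprM qn_neq1 // muln_gt0 d0.
- exact: fraction_nz2.
Qed.

Lemma square_congr t : (3 <= d)%N -> (m.+1 = d * t)%N ->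
  Omul O (tofrac (Phi m) ^+ 2) (\sum_(k < m) vwp_term a b p q 1 1 k).
Proof.
move=> d3 def_t; have t0 : (0 < t)%N by case: t def_t => //; rewrite muln0.
have le_tm : (3 * t <= m.+1)%N by rewrite def_t leq_mul2r d3 orbT.
have er : (d * (m - t) + 1 = d.-1 * m)%N.
  have h : (0 < d.-1 * m)%N by rewrite muln_gt0 m0 andbT; lia.
  have e : (d * m = m + d.-1 * m)%N by rewrite -mulSn prednK.
  by rewrite mulnBr -def_t e; lia.
have eX s : (1 - q * p ^+ (m - t) * p ^+ s) = 1 - q ^+ (d.-1 * m + d * s).
  by rewrite -!exprM -exprS -exprD -[(d * (m - t)).+1]addn1 er.
(* Here r = m - t gives d r + 1 = (d - 1) m, and s0 = t - 1 gives p^(s0+1) / q = q^m. The condition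
   2 s0 < r amounts to 3 t <= m + 1 = d t. *)
apply: (@vwp_square_sum F O _ OR _ a b p _ _ _ q m (m - t) _ _ _ _ _ _ _ _ _ t.-1) => //.
- exact: localised_tofrac.
- exact: Ounit_const.
- exact: Ounit_const.
- by apply: (OunitX OR); apply: Ounit_q.
- exact: Ounit_q.
- by lia.
- by apply: (Omul_qpr _ er); apply: dvdn_mull.
- by move=> s /ndvd_mul h; rewrite -exprM; apply: Ounit_qn.
- by move=> y s; apply: Ounit_ab.
- by move=> s; rewrite -exprM qn_neq1 // muln_gt0 d0.
- exact: fraction_nz2.
- by move=> s /ndvd_mul h; rewrite eX; apply: Ounit_qn; rewrite dvdn_addr // dvdn_mull.
- by move=> s; rewrite -exprM -exprS qn_neq1.
- have -> : p / q * p ^+ t.-1 = q ^+ m.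
    have qn0 : q != 0 by rewrite tofrac_eq0 polyX_eq0.
    apply: (mulfI qn0); rewrite -exprS def_t mulrA mulrCA divff // mulr1.
    by rewrite -exprS prednK // -exprM.
  by apply: Omul_qn.
- by lia.
Qed.

End MainCongruences.

Lemma neg_inverse_mod m d : (0 < m)%N -> (0 < d)%N -> coprime m d ->
  exists2 r, (r < m)%N & (m %| d * r + 1)%N.
Proof.
move=> m0 d0 co; have [u v e _] := egcdnP m d0.
(* [u] is an inverse of [d] modulo [m], so this is the residue of [- u]. *)
exists ((m.-1 * u) %% m)%N; first by rewrite ltn_mod.
rewrite /dvdn -modnDml modnMmr modnDml mulnCA [(d * u)%N]mulnC e.
have -> : gcdn d m = 1%N by apply/eqP; rewrite gcdnC.
have -> : (m.-1 * (v * m + 1) + 1 = (m.-1 * v + 1) * m)%N.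
  by rewrite mulnDr muln1 mulnA -addnA addn1 prednK // mulnDl mul1n.
by rewrite modnMl.
Qed.

(** * Assembling the congruences over the divisors of [n] *)

Section Sum.

Variables (K : fieldType) (alpha beta : K).
Hypothesis char0 : forall n, n.+1%:R != 0 :> K.
Hypotheses (alpha0 : alpha != 0) (beta0 : beta != 0).
Hypothesis alphaX : forall m, alpha ^+ m.+1 != 1.
Hypothesis betaX : forall m, beta ^+ m.+1 != 1.

Local Notation F := {fraction {poly K}}.
Local Notation Phi := (cyclotomic_poly K).
Local Notation q := (tofrac 'X : F).
Local Notation a := (tofrac alpha%:P : F).
Local Notation b := (tofrac beta%:P : F).

Variables (n d : nat).
Hypotheses (n_gt0 : (0 < n)%N) (d_ge3 : (3 <= d)%N) (co_nd : coprime n d).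

Definition vwp_sum : F := (1 - q)^-1 * \sum_(k < n) vwp_term a b (q ^+ d) q 1 1 k.

Lemma vwp_sum_Omul m e : (1 < m)%N ->
  Omul (localised (Phi m)) e (\sum_(k < n) vwp_term a b (q ^+ d) q 1 1 k) ->
  Omul (localised (Phi m)) e vwp_sum.
Proof.
move=> m1; apply: (OmulMl (localised_subring _)); apply: Ounit_OV.
by rewrite -(expr1 q); apply: Ounit_qn; rewrite // dvdn1 neq_ltn m1 orbT.
Qed.

(** The range of summation consists of [n / m] blocks of length [m]. *)
Lemma vwp_sum_congr m : (m %| n)%N -> m != 1%N -> rat_congr vwp_sum 0 (Phi m).
Proof.
move=> m_n m_neq1; have m0 : (0 < m)%N by apply: dvdn_gt0 m_n.
have m1 : (1 < m)%N by rewrite ltn_neqAle eq_sym m_neq1.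
have d0 : (0 < d)%N by apply: leq_trans d_ge3.
have co : coprime m d by apply: coprime_dvdl m_n co_nd.
have [r lt_rm dv] := neg_inverse_mod m0 d0 co.
apply: (@rat_congr0_Omul _ _ _ 1); rewrite expr1; apply: vwp_sum_Omul => //.
have := block_congr char0 alpha0 beta0 alphaX betaX d0 m1 co (n %/ m) lt_rm dv.
by rewrite divnK.
Qed.

(** The starting point of the product over the divisors, which is empty for [n = 1]. *)
Lemma vwp_sum_congr1 : rat_congr vwp_sum 0 1.
Proof.
have [n1|n_neq1] := eqVneq n 1%N; last first.
  exact: (rat_congr0_1 (vwp_sum_congr (dvdnn n) n_neq1)).
apply: rat_congr0P; exists 1, 1; rewrite oner_neq0 coprimep1 dvd1p; split => //.
rewrite /vwp_sum n1 big_ord1 /vwp_term /vwp_ratio !big_ord0 muln0 !expr0 !mulr1.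
rewrite expr1n mulr1 divr1 mulVf ?tofrac1 //.
by have := qn_neq1 K (ltn0Sn 0); rewrite expr1.
Qed.

Lemma vwp_sum_congr_qint : rat_congr vwp_sum 0 (qint_poly K n).
Proof.
rewrite qint_poly_prod // -big_filter -[X in rat_congr _ _ X]mul1r.
apply: rat_congr0_prod; rewrite ?filter_uniq ?divisors_uniq //.
- move=> m; rewrite mem_filter -dvdn_divisors // => /andP[m1 m_n].
  exact: vwp_sum_congr.
- by move=> m _; apply: coprime1p.
- move=> i j; rewrite !mem_filter -!dvdn_divisors // => /andP[_ i_n] /andP[_ j_n].
  exact: coprimep_cyclotomic i_n j_n.
- exact: vwp_sum_congr1.
Qed.

Lemma vwp_sum_congr_square : (d %| n.+1)%N ->
  rat_congr vwp_sum 0 (qint_poly K n * Phi n).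
Proof.
case/dvdnP=> t def_t.
(* For [n = 1] the number [d >= 3] would divide 2. *)
have n1 : (1 < n)%N.
  case: n n_gt0 def_t => [|[|]] // _ def_t.
  by have := dvdn_mull t (dvdnn d); rewrite -def_t => /(dvdn_leq (ltn0Sn _)); lia.
have d0 : (0 < d)%N by apply: leq_trans d_ge3.
have sq : rat_congr vwp_sum 0 (Phi n ^+ 2).
  apply: rat_congr0_Omul; apply: vwp_sum_Omul => //.
  apply: (square_congr char0 alpha0 beta0 alphaX betaX d0 n1 co_nd d_ge3 (t := t)).
  by rewrite mulnC.
have n_neq1 : n != 1%N by rewrite neq_ltn n1 orbT.
(* Splitting Phi_n off [[n]] makes the modulus Phi_n^2 times the Phi_m with [m] different from 1 and
   [n]. *)
rewrite qint_poly_prod // -big_filter (bigD1_seq n) /= ?filter_uniq ?divisors_uniq //; last first.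
  by rewrite mem_filter n_neq1 -dvdn_divisors ?dvdnn.
rewrite mulrAC -expr2 -big_filter.
apply: rat_congr0_prod; rewrite ?filter_uniq ?divisors_uniq //.
- move=> m; rewrite !mem_filter -dvdn_divisors // => /and3P[_ m1 m_n].
  exact: vwp_sum_congr.
- move=> m; rewrite !mem_filter -dvdn_divisors // => /and3P[neq _ m_n].
  by rewrite coprimep_expl // (coprimep_cyclotomic char0 n_gt0) // eq_sym.
move=> i j; rewrite !mem_filter -!dvdn_divisors // => /and3P[_ _ i_n] /and3P[_ _ j_n].
exact: coprimep_cyclotomic i_n j_n.
Qed.

End Sum.

(** * Specialisation to the coefficient field Q(a, b) *)

Lemma fraction_char0 n : n.+1%:R != 0 :> coeffs.
Proof.
rewrite -(rmorph_nat (@FracField.tofrac {poly {poly rat}})) tofrac_eq0.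
by rewrite -polyC_natr polyC_eq0 -polyC_natr polyC_eq0 Num.Theory.pnatr_eq0.
Qed.

Lemma tofrac_expn_neq1 (R : idomainType) (x : R) m :
  x ^+ m != 1 -> (tofrac x : {fraction R}) ^+ m != 1.
Proof. by rewrite -tofracXn -tofrac1 tofrac_eq. Qed.

Lemma polyXn_neq1 (R : idomainType) m : 'X^(m.+1) != 1 :> {poly R}.
Proof. by apply/eqP => h; have := size_polyXn R m.+1; rewrite h size_poly1. Qed.

Theorem theorem1p1 (n d : nat) (n_gt0 : (0 < n)%N) (d_ge3 : (3 <= d)%N)
    (co_nd : coprime n d) :
  let a := inda in
  let b := indb in
  let q := indq in
  let S : ratfuns :=
    \sum_(0 <= k < n)
      qint q (2 * d * k + 1)%N
      * ((qpochs [:: a * q; q / a; b * q; q / b] (q ^+ d) k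
            * qpoch q (q ^+ d) k ^+ 2)
         / (qpochs [:: a * q ^+ d; q ^+ d / a; b * q ^+ d; q ^+ d / b]
              (q ^+ d) k
            * qpoch (q ^+ d) (q ^+ d) k ^+ 2))
      * q ^+ ((2 * d - 3) * k) in
  if (n == -1 %[mod d])%Z
  then rat_congr S 0 (qint_poly coeffs n * cyclotomic_poly coeffs n)
  else rat_congr S 0 (qint_poly coeffs n).
Proof.
move=> a b q S.
pose alpha : coeffs := tofrac (polyC 'X : {poly {poly rat}}).
pose beta : coeffs := tofrac ('X : {poly {poly rat}}).
have alpha0 : alpha != 0 by rewrite tofrac_eq0 polyC_eq0 polyX_eq0.
have beta0 : beta != 0 by rewrite tofrac_eq0 polyX_eq0.
have a0 : a != 0 by rewrite /a /inda tofrac_eq0 polyC_eq0 (negPf alpha0).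
have b0 : b != 0 by rewrite /b /indb tofrac_eq0 polyC_eq0 (negPf beta0).
have q0 : q != 0 by rewrite /q /indq tofrac_eq0 polyX_eq0.
have alphaX m : alpha ^+ m.+1 != 1.
  apply: tofrac_expn_neq1; rewrite -polyC_exp -polyC1.
  by rewrite (inj_eq (@polyC_inj _)) polyXn_neq1.
have betaX m : beta ^+ m.+1 != 1 by apply: tofrac_expn_neq1; apply: polyXn_neq1.
have -> : S = vwp_sum alpha beta n d.
  rewrite /S big_mkord /vwp_sum mulr_sumr; apply: eq_bigr => k _.
  exact: (summandE k a0 b0 q0 d_ge3).
have ch := fraction_char0.
case: ifP => [|_]; last exact: vwp_sum_congr_qint.
rewrite eqz_mod_dvd opprK => dv.
by apply: vwp_sum_congr_square => //; rewrite -addn1.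
Qed.
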